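(* Let $n\ge 1$ be an integer and let $J$ be a countable set. For each $j\in J$, let $m_j$ be a positive integer, let $P_j:\mathbb{R}^{nm_j}\to\mathbb{R}$ be a not identically zero polynomial in $nm_j$ variables with rational coefficients, and let $\Phi_{j,1},\ldots,\Phi_{j,m_j}$ be $C^1$ smooth diffeomorphisms of $\mathbb{R}^n$. Assume that $d\ge 1$ is the maximum degree of the polynomials $P_j$ ($j\in J$). Then there exists a compact set $E\subset\mathbb{R}^n$ of Hausdorff dimension $n/d$ such that for every $j\in J$, $E$ does not contain $m_j$ distinct points $x_1,\ldots,x_{m_j}$ satisfying $$P_j(\Phi_{j,1}(x_1),\ldots,\Phi_{j,m_j}(x_{m_j}))=0.$$
   Context: For a polynomial $P$ in $nm$ variables and points $y_1,\ldots,y_m\in\mathbb{R}^n$ with $y_i=(y_{i,1},\ldots,y_{i,n})$, $P(y_1,\ldots,y_m)$ means $P(y_{1,1},\ldots,y_{1,n},\ldots,y_{m,1},\ldots,y_{m,n})$. Degree means total degree. *)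

(* Defs.v *)
From HB Require Import structures.
From mathcomp Require Import all_boot all_order all_algebra.
From mathcomp Require Import all_classical all_reals all_analysis.
(* The notations of [mpoly] clash with those of analysis. *)
From mathcomp Require Import -(notations) mpoly.

Set Implicit Arguments.
Unset Strict Implicit.
Unset Printing Implicit Defensive.

Import Order.TTheory GRing.Theory Num.Theory.
Import numFieldNormedType.Exports.

Local Open Scope classical_set_scope.
Local Open Scope ring_scope.

Section Hausdorff.
Context {R : realType} {n : nat}.
Implicit Types (x y : 'rV[R]_n) (A : set 'rV[R]_n) (U : nat -> set 'rV[R]_n).

(* The norm of the library on ['rV[R]_n] is the sup norm. *)
Definition eucl_dist x y : R := Num.sqrt (\sum_i (x 0 i - y 0 i) ^+ 2).

Local Open Scope ereal_scope.

(* [maxe 0] only matters for [A = set0], where [ereal_sup] is [-oo]. *)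
Definition diam A : \bar R :=
  maxe 0 (ereal_sup [set (eucl_dist p.1 p.2)%:E | p in A `*` A]).

(* [diam A ^ s], with the convention that it is 0 for the empty set also when
   s = 0; for a one-point set and s = 0 it is 0 `^ 0 = 1. *)
Definition hausdorff_weight (s : R) A : \bar R :=
  if `[< A = set0 >] then 0 else diam A `^ s.

(* Finite covers are included, by padding with empty sets. *)
Definition delta_cover (delta : R) A U : Prop :=
  A `<=` \bigcup_k U k /\ forall k, diam (U k) <= delta%:E.

Definition hausdorff_content (s delta : R) A : \bar R :=
  ereal_inf [set \sum_(0 <= k <oo) hausdorff_weight s (U k)
            | U in [set U | delta_cover delta A U]].

(* The content is nonincreasing in delta, so its limit as delta tends to 0
   is a supremum. *)
Definition hausdorff_measure (s : R) A : \bar R :=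
  ereal_sup [set hausdorff_content s delta A | delta in [set delta | 0 < delta]%R].

Definition hausdorff_dim A : \bar R :=
  ereal_inf [set s%:E | s in [set s | (0 <= s)%R /\ hausdorff_measure s A = 0]].

End Hausdorff.

Section Diffeomorphisms.
Context {R : realType} {n : nat}.
Implicit Types f : 'rV[R]_n -> 'rV[R]_n.

Definition C1_map f : Prop :=
  (forall x, differentiable f x) /\ continuous (fun x => 'J f x).

Definition C1_diffeo f : Prop :=
  C1_map f /\ exists g, [/\ cancel f g, cancel g f & C1_map g].

End Diffeomorphisms.

Definition mpoly_deg {N : nat} (P : mpoly N rat) : nat :=
  (mmeasure mdeg P).-1.

(* P(y_1, ..., y_m), where y_i is row i of Y: [mxvec] lists the entries of Y
   row by row, so that y_{i,k} is substituted for variable number i * n + k. *)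
Definition eval_rows {R : realType} {m n : nat} (P : mpoly (m * n) rat)
    (Y : 'M[R]_(m, n)) : R :=
  meval (fun k => mxvec Y 0 k) (map_mpoly ratr P).

(* Main.v *)
Require Import Defs.
From HB Require Import structures.
From mathcomp Require Import all_boot all_order all_algebra.
From mathcomp Require Import all_classical all_reals all_analysis.
From mathcomp Require Import -(notations) mpoly.
From mathcomp Require Import ring lra zify.

Set Implicit Arguments.
Unset Strict Implicit.
Unset Printing Implicit Defensive.

Import Order.TTheory GRing.Theory Num.Theory.
Import numFieldNormedType.Exports.

Local Open Scope classical_set_scope.
Local Open Scope ring_scope.

(* E is the intersection of nested finite unions of balls (in the sup norm).
   At stage k, dedicated to some P_j and to some labelling of points by
   1, ..., m_j, a ball with label i is replaced by balls of radius eps / M^d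
   centred at the Phi_{j,i}-preimages of points of a lattice (sigma_i + Z^n) / M.
   The rational shift sigma = v / q is chosen so that the leading form of P_j,
   scaled to integer coefficients, is not divisible by q at v; this forces
   |P_j| >= c / M^d at all m_j-tuples of lattice points, and hence P_j has no
   zero near them.  Any distinct x_1, ..., x_{m_j} in E get the labels
   1, ..., m_j at some stage.  A ball has about M^n children of radius about
   M^-d, so E has dimension n / d if M = M_k grows fast enough. *)

(** * Values of a polynomial on a shifted lattice *)

(** The order of the choices shapes the proof. Shift and gap do not depend on [M], and a label is a
    function on all of space, so the constants [L k] and [eps k] of every stage are fixed before any
    ball exists; only then are the [M k] chosen, one after another. Over a countable family these
    constants admit no common bound: the growth of [M k] has to absorb them. A labelling helps only
    once the balls are small compared with the distances between the chosen points, so each must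
    recur at arbitrarily late stages. The exponent comes from [(M^-d)^(n/d) = M^-n], which balances
    the number of children up to constants. The upper bound needs only one good level at a time; the
    lower bound is a mass distribution argument and needs an estimate at every size between two
    consecutive radii. The measure is replaced by a finite quantity: the proportion of the balls of
    a level that meet a set. *)

Lemma base_repr_inj (N b : nat) (x y : 'I_N -> nat) :
  (forall k, x k < b)%N -> (forall k, y k < b)%N ->
  (\sum_k x k * b ^ k)%N = (\sum_k y k * b ^ k)%N -> x =1 y.
Proof.
elim: N x y => [|N IH] x y xb yb; first by move=> _ [].
rewrite !big_ord_recl !expn0 !muln1.
have E (z : 'I_N.+1 -> nat) : (\sum_(i < N) z (lift ord0 i) * b ^ (lift ord0 i))%N
    = (b * \sum_(i < N) z (lift ord0 i) * b ^ i)%N.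
  by rewrite big_distrr; apply: eq_bigr => i _; rewrite /= expnS mulnCA.
rewrite !E => Exy.
have b0 : (0 < b)%N by exact: leq_ltn_trans (xb ord0).
have E0 : x ord0 = y ord0.
  have := congr1 (modn^~ b) Exy.
  by rewrite /= ![(b * _)%N]mulnC ![(_ + _ * b)%N]addnC !modnMDl !modn_small.
have /IH El : (\sum_(i < N) x (lift ord0 i) * b ^ i =
            \sum_(i < N) y (lift ord0 i) * b ^ i)%N.
  move: Exy; rewrite E0 => /addnI /eqP.
  by rewrite eqn_pmul2l// => /eqP.
move=> k; case: (unliftP ord0 k) => [j ->|->//].
exact: El.
Qed.

(* Kronecker substitution [x_k = t ^ (b ^ k)] keeps distinct monomials
   distinct, which reduces the claim to one variable. *)
Lemma int_nonroot (N : nat) (s : seq (multinom N)) (a : multinom N -> int) :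
  uniq s -> s != [::] -> (forall m, m \in s -> a m != 0) ->
  exists v : 'I_N -> int, \sum_(m <- s) a m * \prod_k v k ^+ (m k) != 0.
Proof.
move=> us sn0 a0.
(* A base above every total degree, hence above every exponent: the exponents become base-[b]
   digits. *)
pose b := (\max_(m <- s) mdeg m).+1.
have mb m k : m \in s -> (m k < b)%N.
  move=> ms; rewrite ltnS; apply: leq_trans (@leq_bigmax_seq _ s xpredT mdeg m ms isT).
  by rewrite mdegE (bigD1 k)//= leq_addr.
pose e (m : multinom N) := (\sum_k m k * b ^ k)%N.
pose Q : {poly int} := \sum_(m <- s) a m *: 'X^(e m).
have Q0 : Q != 0.
  have [m0 m0s] : exists m0, m0 \in s by case: (s) sn0 => // m0 s' _; exists m0; rewrite mem_head.
  apply/negP => /eqP/(congr1 (fun p : {poly int} => p`_(e m0))).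
  rewrite coef0 /Q (bigD1_seq m0)//= coefD coefZ coefXn eqxx mulr1 coef_sum.
  rewrite big_seq_cond big1 ?addr0; first by apply/eqP/a0.
  move=> m /andP[ms mm0]; rewrite coefZ coefXn; case: eqP => [E|_]; rewrite ?mulr0//.
  case/negP: mm0; rewrite eq_sym; apply/eqP/mnmP => k.
  by apply: (base_repr_inj (b := b)) => // i; apply: mb.
have [t Qt] : exists t : int, Q.[t] != 0.
  apply: contrapT => /forallNP H.
  have := max_poly_roots (p := Q) (rs := [seq i%:Z | i <- iota 0 (size Q)]) Q0.
  rewrite size_map size_iota ltnn => F.
  suff : false by []; apply: F.
  - by apply/allP => x _; rewrite rootE; apply/negPn/negP => /H.
  - by rewrite map_inj_uniq ?iota_uniq// => ? ? [].
exists (fun k => t ^+ (b ^ k)%N); apply: contraNneq Qt => H0.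
rewrite -{}H0 /Q horner_sum; apply/eqP/eq_bigr => m _.
rewrite hornerZ hornerXn /e; congr (_ * _).
rewrite -prodrXr; apply: eq_bigr => k _; by rewrite -exprM mulnC.
Qed.

Lemma common_denominator (s : seq rat) :
  exists2 D : nat, (0 < D)%N & forall c, c \in s -> exists a : int, D%:R * c = a%:~R.
Proof.
elim: s => [|c s [D D0 IH]]; first by exists 1%N.
exists (D * `|denq c|)%N; first by rewrite muln_gt0 D0 absz_gt0 denq_neq0.
have dE : (`|denq c|%N%:R : rat) = (denq c)%:~R by rewrite -absz_denq.
move=> c'; rewrite in_cons => /orP[/eqP->|/IH[a E]].
  exists (D%:Z * numq c); rewrite natrM dE -mulrA [(denq c)%:~R * c]mulrC.
  by rewrite -numqE rmorphM.
exists (a * denq c); rewrite natrM dE mulrAC E rmorphM//.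
Qed.

(* With [sigma = v / q], at a point of the lattice [(sigma + Z^N) / M] the value
   of [P], scaled by [D * (q M) ^ deg P] to an integer, is congruent modulo [q] to the value of
   the scaled top-degree form at [v], which is not divisible by [q]. *)
Lemma mpoly_lattice_gap (R : realType) (N : nat) (P : mpoly N rat) : P != 0 ->
  exists (sigma : 'I_N -> R) (e : R), 0 < e /\
    forall (M : nat) (y : 'I_N -> R), (0 < M)%N ->
      (forall k, exists w : int, y k * M%:R = sigma k + w%:~R) ->
      e <= `|meval y (map_mpoly ratr P)| * M%:R ^+ mpoly_deg P.
Proof.
move=> P0; set dl := mpoly_deg P.
have [D D0 HD] := common_denominator [seq mcoeff m P | m <- msupp P].
have HD' (m : multinom N) : exists a : int, m \in msupp P -> D%:R * mcoeff m P = a%:~R.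
  have [ms|] := boolP (m \in msupp P); last by exists 0.
  by have [a Ea] := HD _ (map_f (fun m => mcoeff m P) ms); exists a.
have [a Ha] := choice HD'.
have mle (m : multinom N) : m \in msupp P -> (mdeg m <= dl)%N.
  by move=> ms; rewrite /dl /mpoly_deg -ltnS; have := mmeasure_mnm_lt mdeg ms; case: mmeasure.
pose top := [seq m <- msupp P | mdeg m == dl].
have top0 : top != [::].
  have : mmeasure mdeg P != 0%N by rewrite mmeasure_poly_eq0.
  rewrite -has_filter => mn0.
  have sn0 : msupp P != [::] by rewrite -(mmeasure_msupp0 mdeg).
  have [m ms Em] : exists2 m, m \in msupp P & (mdeg m).+1 = mmeasure mdeg P.
    rewrite mmeasureE.
    elim: (msupp P) sn0 => // m [|m' s] IH _.
      by exists m; rewrite ?mem_head// big_cons big_nil maxn0.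
    have [//|m1 m1s E1] := IH; rewrite big_cons.
    case: (leqP (mdeg m).+1 (\max_(j <- m' :: s) (mdeg j).+1)) => H.
      by exists m1 => //; rewrite in_cons m1s orbT.
    by exists m => //; rewrite mem_head.
  by apply/hasP; exists m => //; rewrite /dl /mpoly_deg -Em.
have an0 (m : multinom N) : m \in top -> a m != 0.
  rewrite mem_filter => /andP[_ ms]; rewrite -(intr_eq0 rat) -Ha//.
  by rewrite mulf_neq0 ?pnatr_eq0 -?lt0n// -mcoeff_msupp.
have [v Hv] := int_nonroot (filter_uniq _ (msupp_uniq P)) top0 an0.
set A : int := \sum_(m <- _) _ in Hv.
(* [A] is nonzero and smaller than [q] in absolute value, so [q] does not divide it. *)
pose q := `|A|.+1; have q1 : (1 < q)%N by rewrite ltnS absz_gt0.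
have q0R : (q%:R : R) != 0 by rewrite pnatr_eq0.
(* The constant undoes the scaling of a nonzero integer, whose absolute value is at least 1. *)
exists (fun k => (v k)%:~R / q%:R), (D%:R * q%:R ^+ dl)^-1; split.
  by rewrite invr_gt0 mulr_gt0 ?exprn_gt0 ?ltr0n.
move=> M y M0 /choice[w Hw].
have M0R : (M%:R : R) != 0 by rewrite pnatr_eq0 -lt0n.
pose z k : int := v k + q%:Z * w k.
have yz k : y k * (q%:R * M%:R) = (z k)%:~R.
  rewrite mulrCA Hw mulrDr mulrCA divff// mulr1 /z rmorphD rmorphM//.
(* The missing degree [dl - mdeg m] of a lower monomial is made up by powers of [q * M], which
   vanish modulo [q]; only the top form survives, whatever [M] is. *)
pose I : int := \sum_(m <- msupp P) a m * (q * M)%N%:Z ^+ (dl - mdeg m) * \prod_k z k ^+ (m k).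
have EI : D%:R * (q%:R * M%:R) ^+ dl * meval y (map_mpoly ratr P) = I%:~R :> R.
  rewrite mevalE (perm_big _ (msupp_map_mpoly P (fmorph_inj _))) /=.
  rewrite rmorph_sum big_distrr /=; apply: eq_big_seq => m ms.
  rewrite mcoeff_map_mpoly !rmorphM !rmorphXn /= -pmulrn natrM -(subnKC (mle _ ms)) exprD addKn.
  rewrite rmorph_prod /=.
  have -> : (a m)%:~R = D%:R * ratr (mcoeff m P) :> R.
    by rewrite -(ratr_int R) -Ha// rmorphM /= ratr_nat.
  transitivity (D%:R * ratr (mcoeff m P) * (q%:R * M%:R) ^+ (dl - mdeg m)
     * ((q%:R * M%:R) ^+ mdeg m * \prod_(i < N) y i ^+ m i) : R).
    move: (_ ^+ (dl - _)) (_ ^+ mdeg m) (ratr _) (\prod_(i < N) _) (D%:R) => a1 a2 a3 a4 a5; ring.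
  congr (_ * _); rewrite mdegE -prodrXr -big_split; apply: eq_bigr => k _ /=.
  by rewrite rmorphXn /= -yz mulrC -exprMn.
have I0 : I != 0.
  apply/eqP => I0.
  have : (I%:~R : 'Z_q) = A%:~R.
    have qZ : (q%:R : 'Z_q) = 0 by apply/val_inj; rewrite /= val_Zp_nat// modnn.
    have zv k : (z k)%:~R = (v k)%:~R :> 'Z_q.
      by rewrite rmorphD rmorphM /= -pmulrn qZ mul0r addr0.
    rewrite !rmorph_sum /= /top big_filter [RHS]big_mkcond /=.
    apply: eq_big_seq => m ms; rewrite !rmorphM rmorphXn /= -pmulrn natrM qZ mul0r.
    case: eqP => [->|/eqP ne].
      rewrite subnn expr0 mulr1; congr (_ * _); rewrite !rmorph_prod.
      by apply: eq_bigr => k _; rewrite !rmorphXn /= zv.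
    by rewrite expr0n subn_eq0 leqNgt ltn_neqAle ne mle//= mulr0 mul0r.
  rewrite I0 => /esym.
  have : (`|A|%N%:R : 'Z_q) != 0.
    apply/eqP => /(congr1 val); rewrite /= val_Zp_nat// modn_small ?ltnSn// => /eqP.
    by rewrite absz_eq0 (negPf Hv).
  move=> An; apply/eqP; move: An; case: (A) => k /=; first by rewrite -pmulrn.
  by rewrite NegzE rmorphN oppr_eq0.
rewrite -[leLHS]mul1r ler_pdivrMr ?mulr_gt0 ?exprn_gt0 ?ltr0n//.
have -> : `|meval y (map_mpoly ratr P)| * M%:R ^+ dl * (D%:R * q%:R ^+ dl) = `|I%:~R| :> R.
  rewrite -EI !normrM !normrX !normrM !normr_nat exprMn.
  rewrite [RHS]mulrC -!mulrA; congr (_ * _).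
  by rewrite mulrCA; congr (_ * _); rewrite mulrC.
by rewrite -intr_norm ler1z -gtz0_ge1 normr_gt0.
Qed.

(** * Lipschitz estimates in the sup norm *)

Section SupNorm.
Context {R : realType}.

Lemma mx_norm_entry (p n : nat) (x : 'M[R]_(p, n)) i j : `|x i j| <= `|x|.
Proof.
rewrite [leRHS]/Num.norm /= mx_normrE.
by apply/bigmax_geP; right; exists (i, j).
Qed.

Lemma mx_norm_le (p n : nat) (x : 'M[R]_(p, n)) (e : R) :
  0 <= e -> (forall i j, `|x i j| <= e) -> `|x| <= e.
Proof.
move=> e0 xe; rewrite [leLHS]/Num.norm /= mx_normrE.
by apply: bigmax_le => // -[i j] _; exact: xe.
Qed.

Lemma mulmx_norm_le (n p : nat) (v : 'rV[R]_n) (A : 'M[R]_(n, p)) :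
  `|v *m A| <= n%:R * `|v| * `|A|.
Proof.
apply: mx_norm_le => [|i j]; first by rewrite !mulr_ge0.
rewrite mxE (le_trans (ler_norm_sum _ _ _))//.
apply: (@le_trans _ _ (\sum_(k < n) `|v| * `|A|)).
  by apply: ler_sum => k _; rewrite normrM ler_pM// mx_norm_entry.
by rewrite sumr_const card_ord -[leLHS]mulr_natl mulrA.
Qed.

Lemma closed_ball0_compact (n : nat) (e : R) : compact [set x : 'rV[R]_n | `|x| <= e].
Proof.
apply: bounded_closed_compact.
  by exists e; split => [|M eM x /= xe]; rewrite ?num_real// (le_trans xe)// ltW.
have -> : [set x : 'rV[R]_n | `|x| <= e] = (fun x : 'rV[R]_n => `|x|) @^-1` [set y | y <= e] by [].
by apply: closed_comp; [move=> x _; exact: norm_continuous | exact: closed_le].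
Qed.

Lemma continuous_bounded_on_ball (n : nat) (W : normedModType R) (f : 'rV[R]_n -> W) (e : R) :
  continuous f -> exists B : R, forall x, `|x| <= e -> `|f x| <= B.
Proof.
move=> cf.
have : compact (f @` [set x : 'rV[R]_n | `|x| <= e]).
  apply: continuous_compact; last exact: closed_ball0_compact.
  exact: continuous_subspaceT.
move=> /compact_bounded [B [_ HB]]; exists (B + 1) => x xe.
by apply: (HB (B + 1)); [rewrite ltrDl | exists x].
Qed.

(** The mean value theorem is applied to each coordinate along the segment from [y] to [x], which
    stays in the ball, where compactness bounds the Jacobian. In the sup norm, one coordinate at a
    time is enough. *)
Lemma C1_lipschitz_on_ball (n : nat) (f : 'rV[R]_n -> 'rV[R]_n) (e : R) :
  C1_map f -> exists L : R, forall x y, `|x| <= e -> `|y| <= e ->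
    `|f x - f y| <= L * `|x - y|.
Proof.
move=> [df cJ].
have [B HB] := continuous_bounded_on_ball (f := fun x => 'J f x) e cJ.
exists (n%:R * B) => x y xe ye.
have [-> |xy] := eqVneq x y; first by rewrite !subrr !normr0 mulr0.
have e0 : 0 <= e by exact: le_trans xe.
have B0 : 0 <= B by exact: le_trans (HB x xe).
apply: mx_norm_le => [|i k]; first by rewrite !mulr_ge0.
rewrite ord1 {i}.
pose gam (t : R) := y + t *: (x - y).
pose h (t : R) := f (gam t) 0 k.
pose dh (t : R) := ((x - y) *m 'J f (gam t)) 0 k.
have dgam (t : R) : is_diff t gam (fun s => s *: (x - y)).
  by apply: is_diff_eq; apply/funext => s /=; rewrite add0r.
have @phi : {linear 'rV[R]_n -> R}.
  by exists (fun N : 'rV[R]_n => N 0 k); do 2![eexists]; do ?[constructor];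
     rewrite ?mxE// => ? *; rewrite ?mxE//; move=> ?; rewrite !mxE.
have dphi N : is_diff N phi phi.
  apply: DiffDef; first exact/linear_differentiable/coord_continuous.
  by rewrite diff_lin//; exact: coord_continuous.
have dft (t : R) : is_diff (gam t) f ('d f (gam t)) by apply: DiffDef.
have dht (t : R) : is_derive t 1 h (dh t).
  have Dh : is_diff t h (phi \o ('d f (gam t) \o (fun s => s *: (x - y)))).
    exact: (is_diff_comp (is_diff_comp (dgam t) (dft t)) (dphi _)).
  apply: DeriveDef; first by apply: diff_derivable; apply: ex_diff.
  rewrite deriveE; last exact: ex_diff.
  by rewrite diff_val /= scale1r /dh -deriveEjacobian// deriveE.
have hc : {within `[0, 1], continuous h}.
  apply: derivable_within_continuous => t _; exact: @ex_derive _ _ _ _ _ _ _ (dht t).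
have [c cI] := MVT ltr01 (fun t _ => dht t) hc.
rewrite /h /gam scale1r scale0r addr0 subr0 mulr1 subrKC !mxE => ->.
rewrite (le_trans (mx_norm_entry _ _ _))// (le_trans (mulmx_norm_le _ _))//.
rewrite [leRHS]mulrAC ler_wpM2l ?mulr_ge0// HB// /gam.
move: cI; rewrite in_itv/= => /andP[c0 c1].
have -> : y + c *: (x - y) = (1 - c) *: y + c *: x.
  by apply/rowP => i; rewrite !mxE; ring.
rewrite (le_trans (ler_normD _ _))// !normrZ !gtr0_norm ?subr_gt0//.
by nra.
Qed.

Lemma meval_lipschitz (N : nat) (p : mpoly N R) (B : R) :
  exists K : R, 0 <= K /\ forall (x y : 'I_N -> R) e, 0 <= e ->
    (forall i, `|x i| <= B) -> (forall i, `|y i| <= B) ->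
    (forall i, `|x i - y i| <= e) -> `|meval x p - meval y p| <= K * e.
Proof.
(* Boundedness is carried along with the Lipschitz estimate because the product rule needs both; the
   class is then closed under sums and products. *)
pose Q (F : ('I_N -> R) -> R) := exists K : R, 0 <= K /\
  forall (x y : 'I_N -> R) e, 0 <= e ->
    (forall i, `|x i| <= B) -> (forall i, `|y i| <= B) ->
    (forall i, `|x i - y i| <= e) -> `|F x| <= K /\ `|F x - F y| <= K * e.
have QC c : Q (fun=> c).
  by exists `|c|; split=> // x y e e0 _ _ _; rewrite subrr normr0 mulr_ge0.
have QM F G : Q F -> Q G -> Q (fun x => F x * G x).
  move=> [K [K0 HK]] [L [L0 HL]]; exists (2 * (K * L)); split; first by rewrite !mulr_ge0.
  move=> x y e e0 xB yB xy.
  have [Fx Fxy] := HK _ _ _ e0 xB yB xy; have [Gx Gxy] := HL _ _ _ e0 xB yB xy.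
  have [|Gy _] := HL y y e e0 yB yB; first by move=> i; rewrite subrr normr0.
  split; first by rewrite normrM; have := ler_pM (normr_ge0 _) (normr_ge0 _) Fx Gx; nra.
  have -> : F x * G x - F y * G y = F x * (G x - G y) + (F x - F y) * G y by ring.
  rewrite (le_trans (ler_normD _ _))// !normrM.
  have := ler_pM (normr_ge0 _) (normr_ge0 _) Fx Gxy.
  have := ler_pM (normr_ge0 _) (normr_ge0 _) Fxy Gy.
  lra.
have QD F G : Q F -> Q G -> Q (fun x => F x + G x).
  move=> [K [K0 HK]] [L [L0 HL]]; exists (K + L); split; first by rewrite addr_ge0.
  move=> x y e e0 xB yB xy.
  have [Fx Fxy] := HK _ _ _ e0 xB yB xy; have [Gx Gxy] := HL _ _ _ e0 xB yB xy.
  split; first by rewrite (le_trans (ler_normD _ _))// lerD.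
  have -> : F x + G x - (F y + G y) = (F x - F y) + (G x - G y) by ring.
  by rewrite (le_trans (ler_normD _ _))// mulrDl lerD.
have QX i : Q (fun x => x i).
  exists (`|B| + 1); split; first by rewrite addr_ge0.
  move=> x y e e0 xB _ /(_ i) xy; have := xB i; have := ler_norm B; have := normr_ge0 B.
  by split; nra.
have [K [K0 HK]] : Q (fun x => meval x p).
  under [X in Q X]funext => x do rewrite mevalE.
  elim: (msupp p) => [|m s IH].
    by under [X in Q X]funext => x do rewrite big_nil.
  under [X in Q X]funext => x do rewrite big_cons.
  apply: (QD _ _ _ IH); apply: (QM) => // {IH}.
  elim: (index_enum _) => [|i r IH].
    by under [X in Q X]funext => x do rewrite big_nil.
  under [X in Q X]funext => x do rewrite big_cons.
  apply: (QM _ _ _ IH) => {IH}; elim: (m i) => [|k IH].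
    by under [X in Q X]funext => x do rewrite expr0.
  by under [X in Q X]funext => x do rewrite exprS; apply: (QM).
by exists K; split=> // x y e e0 xB yB xy; have [] := HK _ _ _ e0 xB yB xy.
Qed.

(* [sigma] and [e] do not depend on the scale [M]: a neighbourhood of size
   [e / M ^ d] of the lattice [(sigma + Z^(m n)) / M] avoids the zeros of [P]. *)
Lemma eval_rows_avoidance (m n d : nat) (P : mpoly (m * n) rat) (B : R) :
  P != 0 -> (mpoly_deg P <= d)%N ->
  exists (sigma : 'M[R]_(m, n)) (e : R), 0 < e /\
    forall (M : nat) (Y Z : 'M[R]_(m, n)), (0 < M)%N ->
      (forall i l, exists w : int, Y i l * M%:R = sigma i l + w%:~R) ->
      `|Y| <= B -> `|Z| <= B -> `|Z - Y| * M%:R ^+ d <= e -> eval_rows P Z != 0.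
Proof.
move=> P0 Pd.
have [sigma [e [e0 He]]] := mpoly_lattice_gap R P0.
have [K [K0 HK]] := meval_lipschitz (map_mpoly ratr P) B.
(* [K + 1] is positive even when [K] is 0, and the half leads to the contradiction [e <= e / 2]. *)
exists (\matrix_(i, l) sigma (mxvec_index i l)), (e / (K + 1) / 2).
have K1 : 0 < K + 1 by rewrite ltr_wpDl.
split; first by rewrite !divr_gt0.
move=> M Y Z M0 Hw YB ZB ZY; apply/eqP => Z0.
have M1 : 1 <= M%:R :> R by rewrite ler1n.
have B_entry (W : 'M[R]_(m, n)) c : `|W| <= c -> forall k, `|mxvec W 0 k| <= c.
  by move=> Wc k; case/mxvec_indexP: k => i j; rewrite mxvecE (le_trans (mx_norm_entry _ _ _)).
have := He M (fun k => mxvec Y 0 k) M0.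
have /[swap] /[apply] : forall k, exists w : int, mxvec Y 0 k * M%:R = sigma k + w%:~R.
  move=> k; case/mxvec_indexP: k => i j; rewrite mxvecE.
  by have [w] := Hw i j; rewrite mxE => ?; exists w.
have := HK (fun k => mxvec Y 0 k) (fun k => mxvec Z 0 k) `|Z - Y| (normr_ge0 _)
  (B_entry _ _ YB) (B_entry _ _ ZB) _.
have /[swap] /[apply] : forall k, `|mxvec Y 0 k - mxvec Z 0 k| <= `|Z - Y|.
  by move=> k; rewrite distrC; have := B_entry (Z - Y) _ (lexx _) k; rewrite linearB !mxE.
rewrite -/(eval_rows P Z) Z0 subr0 => H1 H2.
have : e <= K * (`|Z - Y| * M%:R ^+ d).
  apply: (le_trans H2); rewrite mulrA; apply: ler_pM => //.
  by rewrite ler_weXn2l.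
move=> H3; have : e <= K * (e / (K + 1) / 2) by apply: (le_trans H3); rewrite ler_wpM2l.
have -> : K * (e / (K + 1) / 2) = e * (K / (K + 1)) / 2 by ring.
have /(ler_wpM2l (ltW e0)) : K / (K + 1) <= 1 by rewrite ler_pdivrMr// mul1r lerDl.
move: (K / (K + 1)) => t; move: e0; clear; lra.
Qed.

End SupNorm.

(** * Hausdorff dimension of an intersection of nested balls *)

Section HausdorffTools.
Context {R : realType} {n : nat}.
Implicit Types (x y c : 'rV[R]_n) (U : set 'rV[R]_n).

(** Diameters are Euclidean while the construction uses the sup norm; this bound and the next one
    pass between them at the cost of a constant factor. *)
Lemma norm_le_eucl_dist x y : `|x - y| <= eucl_dist x y.
Proof.
apply: mx_norm_le => [|i j]; first exact: sqrtr_ge0.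
rewrite ord1 !mxE -sqrtr_sqr ler_wsqrtr// (bigD1 j)//= lerDl sumr_ge0// => k _.
exact: sqr_ge0.
Qed.

Lemma eucl_dist_le_norm x y : eucl_dist x y <= n%:R * `|x - y|.
Proof.
have h : 0 <= n%:R * `|x - y| by rewrite mulr_ge0.
rewrite -[leRHS]ger0_norm// -sqrtr_sqr ler_wsqrtr// exprMn.
apply: (@le_trans _ _ (\sum_(i < n) `|x - y| ^+ 2)).
  apply: ler_sum => i _; rewrite -[leLHS]real_normK ?num_real// lerXn2r ?nnegrE//.
  by have := mx_norm_entry (x - y) 0 i; rewrite !mxE.
rewrite sumr_const card_ord -[leLHS]mulr_natl ler_wpM2r ?sqr_ge0// -natrX ler_nat.
by case: n => // k; rewrite expnS expn1 leq_pmulr.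
Qed.

Lemma eucl_dist_le_diam U x y : U x -> U y -> ((eucl_dist x y)%:E <= diam U)%E.
Proof.
move=> Ux Uy; rewrite /diam le_max; apply/orP; right.
by apply: ereal_sup_ubound; exists (x, y).
Qed.

Lemma diam_ge0 U : (0 <= diam U)%E.
Proof. by rewrite /diam le_max lexx. Qed.

Lemma diam_le U (e : R) : 0 <= e ->
  (forall x y, U x -> U y -> eucl_dist x y <= e) -> (diam U <= e%:E)%E.
Proof.
move=> e0 Ue; rewrite /diam ge_max lee_fin e0/=.
by apply: ge_ereal_sup => _ [[x y] [/= Ux Uy] <-]; rewrite lee_fin Ue.
Qed.

Lemma diam_closed_ball_le c (r : R) : 0 <= r ->
  (diam [set x : 'rV[R]_n | (`|x - c| <= r)%R] <= (2 * n%:R * r)%:E)%E.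
Proof.
move=> r0; apply: diam_le => [|x y /= xc yc]; first by rewrite !mulr_ge0.
rewrite (le_trans (eucl_dist_le_norm _ _))// [2 * _]mulrC -mulrA ler_wpM2l//.
by rewrite -(subrKA c) (le_trans (ler_normD _ _))// [`|c - y|]distrC; lra.
Qed.

Lemma hausdorff_weight_ge0 (s : R) U : (0 <= hausdorff_weight s U)%E.
Proof. by rewrite /hausdorff_weight; case: ifP => // _; rewrite poweR_ge0. Qed.

Lemma hausdorff_measure_ge0 (s : R) U : (0 <= hausdorff_measure s U)%E.
Proof.
apply: (@le_trans _ _ (hausdorff_content s 1 U)); last by apply: ereal_sup_ubound; exists 1 => /=.
apply: le_ereal_inf_tmp => _ [V _ <-]; apply: nneseries_ge0 => k _ _.
exact: hausdorff_weight_ge0.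
Qed.

Lemma hausdorff_measure_eq0 (s : R) U :
  (forall e : R, 0 < e -> exists V, delta_cover e U V /\
     (\sum_(0 <= k <oo) hausdorff_weight s (V k) <= e%:E)%E) ->
  hausdorff_measure s U = 0%E.
Proof.
move=> H; apply/eqP; rewrite eq_le hausdorff_measure_ge0 andbT.
apply: ge_ereal_sup => _ [delta /= d0 <-]; apply/lee_addgt0Pr => e e0; rewrite add0e.
have m0 : 0 < Num.min delta e by rewrite lt_min d0.
have [V [[UV Vd] Ve]] := H _ m0; apply: ge_ereal_inf.
exists (\sum_(0 <= k <oo) hausdorff_weight s (V k))%E.
  exists V => //; split=> // k; rewrite (le_trans (Vd k))// lee_fin ge_min lexx//.
by rewrite (le_trans Ve)// lee_fin ge_min lexx orbT.
Qed.

Lemma hausdorff_dim_eq U (s0 : R) :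
  (forall s, 0 <= s -> s < s0 -> hausdorff_measure s U <> 0%E) ->
  (forall s, 0 <= s -> s0 < s -> hausdorff_measure s U = 0%E) ->
  0 <= s0 -> hausdorff_dim U = s0%:E.
Proof.
move=> Hlow Hup s00; apply/eqP; rewrite eq_le; apply/andP; split.
  apply/lee_addgt0Pr => e e0; apply: ereal_inf_lbound; exists (s0 + e) => //=.
  have h : s0 < s0 + e by rewrite ltrDl.
  by split; [|apply: Hup => //]; rewrite (le_trans s00)// ltW.
apply: le_ereal_inf_tmp => _ [s [/= s_ge0 Hs] <-]; rewrite lee_fin leNgt.
by apply/negP => /(Hlow _ s_ge0).
Qed.

End HausdorffTools.

(** * Trees of nested balls: counting, limit set, Hausdorff measure *)

Lemma count_allpairs_le (S : eqType) (T W : Type) (f : S -> T -> W) (p : pred W)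
    (q : pred S) (s : seq S) (t : seq T) (b : nat) :
  (forall c, c \in s -> (count (fun u => p (f c u)) t <= q c * b)%N) ->
  (count p [seq f c u | c <- s, u <- t] <= count q s * b)%N.
Proof.
elim: s => //= c s IH H; rewrite count_cat count_map mulnDl leq_add//.
  by apply: H; rewrite mem_head.
by apply: IH => c' c's; apply: H; rewrite in_cons c's orbT.
Qed.

(** Relative to a fixed member [u0] each coordinate moves by at most [D], the integer part of [x],
    in either direction. Shifting by [D - u0 i] thus embeds [S] into a cube with [2 * D + 1] values
    per side, and the natural subtraction never truncates. *)
Lemma card_spread_le (R : realType) (n k : nat) (S : {set {ffun 'I_n -> 'I_k}}) (x : R) :
  0 <= x -> (forall u v i, u \in S -> v \in S -> `|(u i)%:R - (v i)%:R| <= x) ->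
  (#|S| <= (2 * Num.truncn x).+1 ^ n)%N.
Proof.
move=> x0 Sx; have [->|[u0 u0S]] := set_0Vmem S; first by rewrite cards0.
set D := Num.truncn x.
have Sdiff u v i : u \in S -> v \in S -> (u i <= v i + D)%N.
  move=> uS vS; have [|vu] := leqP (u i) (v i); first by move/leq_trans; apply; rewrite leq_addr.
  rewrite -leq_subLR /D truncn_ge_nat// natrB; last exact: ltnW.
  by rewrite (le_trans (ler_norm _))// Sx.
pose f (u : {ffun 'I_n -> 'I_k}) : {ffun 'I_n -> 'I_(2 * D).+1} :=
  [ffun i => inord (u i + D - u0 i)].
have injf : {in S &, injective f}.
  move=> u v uS vS /ffunP E; apply/ffunP => i; apply/val_inj => /=.
  have ha := Sdiff _ _ i uS u0S; have hb := Sdiff _ _ i u0S uS.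
  have hc := Sdiff _ _ i vS u0S; have hd := Sdiff _ _ i u0S vS.
  have := congr1 (@nat_of_ord _) (E i); rewrite !ffunE.
  move: ha hb hc hd; clearbody D; move: (u i : nat) (v i : nat) (u0 i : nat) => a b c ha hb hc hd.
  by rewrite !inordK; lia.
rewrite -(card_in_imset injf) (leq_trans (max_card _))//.
by rewrite card_ffun !card_ord.
Qed.

Section NestedBalls.
Context {R : realType} {n : nat}.
(** A ball of level [k] has radius [rho k] and [kappa k ^ n] children, whose centres are at least
    [1 / lam k] apart. In the application [lam k] is [L k * M k], the inverse lattice spacing up to
    distortion. *)
Variables (kappa : nat -> nat) (rho lam : nat -> R).
Variable child : forall k, 'rV[R]_n -> {ffun 'I_n -> 'I_(kappa k)} -> 'rV[R]_n.
Arguments child : clear implicits.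
Hypotheses (kappa_gt0 : forall k, (0 < kappa k)%N).
Hypotheses (rho0 : rho 0 = 1) (rho_gt0 : forall k, 0 < rho k)
  (rho_half : forall k, rho k.+1 <= rho k / 2).
Hypothesis lam_ge0 : forall k, 0 <= lam k.
Hypothesis child_near : forall k c u, `|c| <= 1 -> `|child k c u - c| <= rho k / 2.
Hypothesis child_separated : forall k c (u v : {ffun 'I_n -> 'I_(kappa k)}) i, `|c| <= 1 ->
  `|(u i)%:R - (v i)%:R| <= lam k * `|child k c u - child k c v|.
Hypothesis rho_lam_small : forall k, 3 * rho k.+1 * lam k < 1.

Fixpoint centers (k : nat) : seq 'rV[R]_n :=
  if k is k'.+1 then [seq child k' c u | c <- centers k', u <- enum {ffun 'I_n -> 'I_(kappa k')}]
  else [:: 0].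

Definition layer k : set 'rV[R]_n := [set x | exists2 c, c \in centers k & `|x - c| <= rho k].

Definition limit_set : set 'rV[R]_n := \bigcap_k layer k.

Definition hits (U : set 'rV[R]_n) (r : R) (c : 'rV[R]_n) : bool :=
  `[< exists2 x, U x & `|x - c| <= r >].

(** Divided by [size (centers k)], this plays the role of the mass of [U] under the uniform
    distribution on the tree, seen at level [k]. *)
Definition hit_count (U : set 'rV[R]_n) k := count (hits U (rho k)) (centers k).

Lemma size_centersS k : size (centers k.+1) = (size (centers k) * kappa k ^ n)%N.
Proof. by rewrite /= size_allpairs -cardE card_ffun !card_ord. Qed.

Lemma size_centers_gt0 k : (0 < size (centers k))%N.
Proof. by elim: k => // k IH; rewrite size_centersS muln_gt0 IH expn_gt0 kappa_gt0. Qed.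

Lemma centers_bound k c : c \in centers k -> `|c| + rho k <= 1.
Proof.
elim: k c => [|k IH] c /=; first by rewrite inE => /eqP->; rewrite normr0 add0r rho0.
move=> /allpairsP[[c' u] [/= c'k _ ->]].
have := IH _ c'k; have := rho_gt0 k; have := rho_half k => h1 h2 h3.
have := child_near u (c := c'); have := ler_normD (child k c' u - c') c'; rewrite subrK.
by move=> h4 h5; have : `|c'| <= 1 by [lra]; move/h5; lra.
Qed.

Lemma centers_norm k c : c \in centers k -> `|c| <= 1.
Proof. by move=> /centers_bound; have := rho_gt0 k; lra. Qed.

Lemma rho_decr k l : (k <= l)%N -> rho l <= rho k.
Proof.
move=> kl; rewrite -(subnKC kl); elim: (l - k)%N => [|j IH]; rewrite ?addn0// addnS.
by have := rho_half (k + j); have := rho_gt0 (k + j); lra.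
Qed.

Lemma rho_le k : rho k <= 2^-1 ^+ k.
Proof.
elim: k => [|k IH]; first by rewrite rho0 expr0.
by rewrite exprS (le_trans (rho_half k))// mulrC ler_wpM2l.
Qed.

Lemma rho_small (e : R) : 0 < e -> exists k, rho k < e.
Proof.
move=> e0; exists (Num.truncn e^-1).
apply: (le_lt_trans (rho_le _)); rewrite exprVn invf_plt ?posrE ?exprn_gt0//.
rewrite (lt_le_trans (truncnS_gt _))// -natrX ler_nat.
exact: ltn_expl.
Qed.

Lemma layer_decr k : layer k.+1 `<=` layer k.
Proof.
move=> x [_ /= /allpairsP[[c u] [/= ck _ ->]] xc]; exists c => //.
have := child_near u (centers_norm ck); have := rho_half k => h1 h2.
by rewrite -[x - c](subrKA (child k c u)) (le_trans (ler_normD _ _))//; lra.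
Qed.

Lemma layer_decr_le k l : (k <= l)%N -> layer l `<=` layer k.
Proof.
move=> kl; rewrite -(subnKC kl); elim: (l - k)%N => [|j IH]; rewrite ?addn0// addnS.
by move=> x /layer_decr/IH.
Qed.

Lemma hits_parent U k c u : c \in centers k ->
  hits U (rho k.+1) (child k c u) -> hits U (rho k) c.
Proof.
move=> ck /asboolP[y Uy yc]; apply/asboolP; exists y => //.
have := child_near u (centers_norm ck); have := rho_half k => h1 h2.
by rewrite -[y - c](subrKA (child k c u)) (le_trans (ler_normD _ _))//; lra.
Qed.

Lemma hit_countS_le U k b :
  (forall c, c \in centers k ->
     (#|[set u : {ffun 'I_n -> 'I_(kappa k)} | hits U (rho k.+1) (child k c u)]%SET| <= b)%N) ->
  (hit_count U k.+1 <= hit_count U k * b)%N.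
Proof.
move=> Hb; apply: count_allpairs_le.
move=> c ck; case hc : (hits U (rho k) c); last first.
  rewrite mul0n leqNgt -has_count; apply/negP => /hasP[u _ /(hits_parent ck)].
  by rewrite hc.
rewrite mul1n; apply: leq_trans (Hb c ck).
rewrite cardE -size_filter; apply: uniq_leq_size; first by apply/filter_uniq/enum_uniq.
by move=> u; rewrite mem_filter => /andP[/= hu _]; rewrite mem_enum inE.
Qed.

(** Two sibling balls of radius [rho k.+1] that both meet [U] have centres at most
    [rho k.+1 + r + rho k.+1 <= 3 * r] apart, so their indices differ by at most [3 * r * lam k] in
    each coordinate. *)
Lemma hit_countS_spread U r k : (forall x y, U x -> U y -> `|x - y| <= r) -> rho k.+1 <= r ->
  (hit_count U k.+1 <= hit_count U k * (2 * Num.truncn (3 * r * lam k)%R).+1 ^ n)%N.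
Proof.
move=> Ur kr; have r0 : 0 <= r by rewrite (le_trans _ kr)// ltW.
apply: hit_countS_le => c ck.
apply: card_spread_le => [|u v i]; first by rewrite !mulr_ge0.
rewrite !inE => -[x Ux xu] [y Uy yv].
apply: (le_trans (child_separated _ _ _ (centers_norm ck))).
rewrite mulrC ler_wpM2r//.
have -> : child k c u - child k c v = - (x - child k c u) + (x - y) + (y - child k c v).
  by apply/rowP => j; rewrite !mxE; ring.
rewrite (le_trans (ler_normD _ _))//.
have := ler_normD (- (x - child k c u)) (x - y); rewrite normrN.
have := Ur _ _ Ux Uy; lra.
Qed.

(** A set no wider than [rho k] follows a single branch down to level [k]: at each level above,
    [rho_lam_small] keeps it from reaching two siblings. *)
Lemma hit_count_le1 U r k : (forall x y, U x -> U y -> `|x - y| <= r) -> r <= rho k ->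
  (hit_count U k <= 1)%N.
Proof.
move=> Ur; elim: k => [|k IH] rk; first by rewrite /hit_count /= addn0 leq_b1.
have Ur' x y : U x -> U y -> `|x - y| <= rho k.+1.
  by move=> Ux Uy; rewrite (le_trans (Ur _ _ Ux Uy)).
have := hit_countS_spread Ur' (lexx _).
have -> : Num.truncn (3 * rho k.+1 * lam k) = 0%N.
  by apply/truncn0Pn; rewrite -ltNge rho_lam_small.
rewrite exp1n muln1 => /leq_trans; apply; apply: IH.
by rewrite (le_trans rk)// rho_decr.
Qed.

(** Cross-multiplied form of a monotonicity: the proportion of balls met by [U] does not increase
    with the level, since a ball that misses [U] has no child meeting it. *)
Lemma hit_count_mono U k l : (k <= l)%N ->
  (hit_count U l * size (centers k) <= hit_count U k * size (centers l))%N.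
Proof.
move=> kl; rewrite -(subnKC kl); elim: (l - k)%N => [|j IH]; rewrite ?addn0// addnS.
rewrite size_centersS mulnA (leq_trans _ (leq_mul IH (leqnn _)))// mulnAC leq_mul//.
apply: hit_countS_le => c _; rewrite (leq_trans (max_card _))//.
by rewrite card_ffun !card_ord.
Qed.

Lemma center_child_chain k c : c \in centers k ->
  exists z : nat -> 'rV[R]_n, [/\ z 0%N = c, forall j, z j \in centers (k + j) &
    forall j l, (j <= l)%N -> `|z l - z j| <= rho (k + j)].
Proof.
move=> ck; pose u0 l : {ffun 'I_n -> 'I_(kappa l)} := [ffun=> Ordinal (kappa_gt0 l)].
pose z := fix z j := if j is j'.+1 then child (k + j') (z j') (u0 _) else c.
have zc j : z j \in centers (k + j).
  elim: j => [|j IH]; first by rewrite addn0.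
  by rewrite addnS /=; apply: allpairs_f => //; rewrite mem_enum.
exists z; split=> // j l /subnKC <-.
(* Strengthened so that the induction telescopes: one step moves the centre by at most [rho / 2],
   which is at most the drop of the radius. *)
suff : `|z (j + (l - j))%N - z j| <= rho (k + j) - rho (k + (j + (l - j))).
  by have := rho_gt0 (k + (j + (l - j))); lra.
elim: (l - j)%N => [|i IH]; first by rewrite addn0 !subrr normr0.
rewrite !addnS /=.
have := child_near (u0 (k + (j + i))) (centers_norm (zc (j + i)%N)).
set w := child _ _ _; have := rho_half (k + (j + i)).
rewrite -[w - z j](subrKA (z (j + i)%N)) => h1 h2; rewrite (le_trans (ler_normD _ _))//; lra.
Qed.

(** A chain of descendants of [c] has a cluster point in the compact unit ball, and this point lies
    in every ball of the chain. Hence a cover of [limit_set] has to meet every ball of every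
    level. *)
Lemma limit_set_meets_ball k c : c \in centers k ->
  exists2 x, limit_set x & `|x - c| <= rho k.
Proof.
move=> ck; have [z [z0 zc zz]] := center_child_chain ck.
have [x [_ xz]] : [set x : 'rV[R]_n | `|x| <= 1] `&` cluster (z @ \oo) !=set0.
  by apply: closed_ball0_compact; exists 0%N => // j _; exact: centers_norm (zc j).
have xzj j : `|x - z j| <= rho (k + j).
  rewrite leNgt; apply/negP => h.
  have [||y [/= y1 y2]] :=
    xz (fun y => `|y - z j| <= rho (k + j)) (ball x (`|x - z j| - rho (k + j))).
  - by exists j => // l /= jl; exact: zz.
  - by apply: nbhsx_ballx; rewrite subr_gt0.
  move: y2; rewrite -ball_normE /= => y2.
  have := ler_normD (x - y) (y - z j); rewrite subrKA; lra.
exists x; last by have := xzj 0%N; rewrite z0 addn0.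
move=> l _; have [lk|kl] := leqP k l.
  by exists (z (l - k)%N); [have := zc (l - k)%N | have := xzj (l - k)%N]; rewrite subnKC.
apply: (layer_decr_le (ltnW kl)); exists c => //.
by have := xzj 0%N; rewrite z0 addn0.
Qed.

Lemma limit_set_compact : compact limit_set.
Proof.
apply: (@subclosed_compact _ _ [set x : 'rV[R]_n | `|x| <= 1]); first last.
- by move=> x /(_ 0%N I) [c /=]; rewrite inE => /eqP->; rewrite subr0 rho0.
- exact: closed_ball0_compact.
apply: closed_bigI => k _.
have -> : layer k = \bigcup_(c in [set` centers k]) [set x | `|x - c| <= rho k].
  by apply/seteqP; split=> x [c cs xc]; exists c.
apply: closed_bigcup; first exact: finite_seq.
move=> c _; rewrite (_ : [set x | _] = closed_ball c (rho k)); first exact: closed_ball_closed.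
by rewrite closed_ballE//; apply/seteqP; split=> x /=; rewrite distrC.
Qed.


Lemma rho_bracket k0 (r : R) : 0 < r -> r <= rho k0 ->
  exists k, [/\ (k0 <= k)%N, rho k.+1 <= r & r <= rho k].
Proof.
move=> r0 rk0.
have ex : exists k, (k0 <= k)%N && (rho k.+1 <= r).
  have [k /ltW kr] := rho_small r0; exists (maxn k0 k).
  by rewrite leq_maxl (le_trans _ kr)// rho_decr// leqW// leq_maxr.
case: (ex_minnP ex) => k /andP[k0k kr] kmin; exists k; split=> //.
move: k0k; rewrite leq_eqVlt => /orP[/eqP <-//|].
case: k kr kmin => // k kr kmin k0k; rewrite leNgt; apply/negP => /ltW h.
by have := kmin k; rewrite h andbT => /(_ k0k); rewrite ltnn.
Qed.

(** Mass at most [r ^ s] for sets of size [r]. With [r] between [rho k.+1] and [rho k], the set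
    meets at most one ball of level [k], hence at most [(6 * lam k * r + 1) ^ n] balls of the next
    level, and later the proportion can only drop. *)
Lemma hit_growth (s : R) k0 :
  (forall k r, (k0 <= k)%N -> rho k.+1 <= r -> r <= rho k ->
    (6 * lam k * r + 1) ^+ n <= (size (centers k.+1))%:R * r `^ s) ->
  forall U r, (forall x y, U x -> U y -> `|x - y| <= r) -> 0 < r -> r <= rho k0 ->
  exists K, forall l, (K <= l)%N -> (hit_count U l)%:R <= (size (centers l))%:R * r `^ s.
Proof.
move=> H U r Ur r0 rk0; have [k [k0k kr rk]] := rho_bracket r0 rk0.
exists k.+1 => l kl.
have T0 : 0 < (size (centers k.+1))%:R :> R by rewrite ltr0n size_centers_gt0.
rewrite -(ler_pM2r T0) -natrM.
apply: (@le_trans _ _ (hit_count U k.+1 * size (centers l))%:R).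
  by rewrite ler_nat hit_count_mono.
rewrite natrM mulrC -mulrA ler_wpM2l// mulrC (le_trans _ (H k r k0k kr rk))//.
set t := 3 * r * lam k; have t0 : 0 <= t by rewrite !mulr_ge0// ltW.
apply: (@le_trans _ _ ((2 * Num.truncn t).+1 ^ n)%:R).
  rewrite ler_nat (leq_trans (hit_countS_spread Ur kr))//.
  by rewrite -[leqRHS]mul1n leq_mul// (hit_count_le1 Ur rk).
rewrite natrX lerXn2r ?nnegrE//; first by rewrite addr_ge0// !mulr_ge0// ltW.
rewrite -natr1 natrM lerD2r; have := truncn_le t; rewrite t0 /t; lra.
Qed.

(** Covering sets are made open so that compactness yields a finite subcover. Adding balls of radius
    [r / 4] to a set of diameter [d <= r / 2] keeps the diameter at most [r]; doubling the diameter
    costs the factor [2 ^ s]. *)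
Lemma open_enlargement (s : R) k0 : 0 <= s ->
  (forall k r, (k0 <= k)%N -> rho k.+1 <= r -> r <= rho k ->
    (6 * lam k * r + 1) ^+ n <= (size (centers k.+1))%:R * r `^ s) ->
  forall U (e : R), (diam U <= (rho k0 / 2)%:E)%E -> 0 < e ->
  exists V, [/\ open V, U `<=` V & exists K, forall l, (K <= l)%N ->
    (hit_count V l)%:R <= (size (centers l))%:R * (2 `^ s * fine (hausdorff_weight s U) + e)].
Proof.
move=> s0 H U e Ud e0; rewrite /hausdorff_weight; case: asboolP => [->|/eqP U0].
  exists set0; split; [exact: open0 | by [] | ].
  exists 0%N => l _; rewrite (_ : hit_count _ _ = 0%N) ?mulr_ge0 ?addr_ge0 ?mulr_ge0// ?ltW//.
  rewrite /hit_count; apply/eqP; rewrite -leqn0 leqNgt -has_count.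
  by apply/negP => /hasP[c _ /asboolP[]].
have : diam U \is a fin_num by rewrite ge0_fin_numE ?diam_ge0// (le_lt_trans Ud)// ltry.
move=> /fineK dE; set d := fine _ in dE; rewrite -dE /=.
have d0 : 0 <= d by rewrite -lee_fin dE diam_ge0.
have dk : d <= rho k0 / 2 by rewrite -lee_fin dE.
have [r [r0 rk dr rs]] : exists r,
    [/\ 0 < r, r <= rho k0, 2 * d <= r & r `^ s <= 2 `^ s * d `^ s + e].
  (* For [s = 0] all powers are 1 and [r] may be as large as [rho k0]. For [s > 0] the diameter [d]
     may vanish, and [t] keeps [r] positive at a cost [t ^ s <= e]. *)
  have [s00|sn0] := eqVneq s 0.
    by exists (rho k0); split=> //; [lra | rewrite s00 !powRr0; lra].
  have sgt0 : 0 < s by rewrite lt0r sn0.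
  pose t := Num.min (rho k0) (e `^ s^-1).
  have t0 : 0 < t by rewrite lt_min rho_gt0 powR_gt0.
  have ts : t `^ s <= e.
    apply: (@le_trans _ _ ((e `^ s^-1) `^ s)).
      by rewrite ge0_ler_powR ?nnegrE ?powR_ge0 ?(ltW t0)// ge_min lexx orbT.
    by rewrite -powRrM mulVf// powRr1// ltW.
  exists (Num.max (2 * d) t); split.
  - by rewrite lt_max t0 orbT.
  - by rewrite ge_max ge_min lexx andbT; lra.
  - by rewrite le_max lexx.
  - have dse : 0 <= 2 `^ s * d `^ s by rewrite mulr_ge0 ?powR_ge0.
    by have [_|_] := leP (2 * d) t; rewrite ?powRM// ?lerDl ?(ltW e0)//; lra.
exists (\bigcup_(y in U) ball y (r / 4)); split.
- by apply: bigcup_open => y _; apply: ball_open; lra.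
- by move=> x Ux; exists x => //; apply: ballxx; lra.
have [|//|//|K HK] := hit_growth H (U := \bigcup_(y in U) ball y (r / 4)) (r := r).
  move=> x x' [y Uy +] [y' Uy' +]; rewrite -!ball_normE /= => h h'.
  have h1 : `|y - y'| <= d.
    by rewrite (le_trans (norm_le_eucl_dist _ _))// -lee_fin dE eucl_dist_le_diam.
  have -> : x - x' = - (y - x) + (y - y') + (y' - x').
    by apply/rowP => j; rewrite !mxE; ring.
  apply: (@le_trans _ _ (r / 4 + d + r / 4)); last by lra.
  apply: (le_trans (ler_normD _ _)); apply: lerD; last exact: ltW.
  by apply: (le_trans (ler_normD _ _)); rewrite normrN; apply: lerD => //; exact: ltW.
by exists K => l Kl; rewrite (le_trans (HK l Kl))// ler_wpM2l.
Qed.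

Lemma limit_set_measure_neq0 (s : R) k0 : 0 <= s ->
  (forall k r, (k0 <= k)%N -> rho k.+1 <= r -> r <= rho k ->
    (6 * lam k * r + 1) ^+ n <= (size (centers k.+1))%:R * r `^ s) ->
  hausdorff_measure s limit_set <> 0%E.
Proof.
move=> s0 H Hm0.
(* A cover of weight below [eta], with errors [eta / 2 ^ j.+1], has total mass at most
   [(2 ^ s + 1) * eta = 1 / 2], while the whole tree has mass 1. *)
pose eta : R := (2 * (2 `^ s + 1))^-1.
have ps : 0 <= 2 `^ s :> R := powR_ge0 _ _.
have eta0 : 0 < eta by rewrite invr_gt0; lra.
have : (hausdorff_content s (rho k0 / 2) limit_set < eta%:E)%E.
  apply: (@le_lt_trans _ _ 0%E); last by rewrite lte_fin.
  by rewrite -Hm0; apply: ereal_sup_ubound; exists (rho k0 / 2) => //=; have := rho_gt0 k0; lra.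
move=> /ereal_inf_lt[_ [U [UE Ud] <-] Ueta].
pose w j := fine (hausdorff_weight s (U j)).
have wE j : hausdorff_weight s (U j) = (w j)%:E.
  rewrite /w fineK// ge0_fin_numE ?hausdorff_weight_ge0// /hausdorff_weight.
  case: asboolP => // _; apply: poweR_lty; apply: le_lt_trans (Ud j) _; exact: ltry.
have sum_w J : \sum_(j < J) w j <= eta.
  rewrite -lee_fin -sumEFin; apply: le_trans (ltW Ueta).
  under eq_bigr do rewrite -wE.
  rewrite -(big_mkord xpredT (fun j => hausdorff_weight s (U j))).
  by apply: nneseries_lim_ge => j _ _; exact: hausdorff_weight_ge0.
have /choice[V HV] : forall j, exists V : set 'rV[R]_n, [/\ open V, U j `<=` V &
    exists K, forall l, (K <= l)%N -> (hit_count V l)%:R <=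
      (size (centers l))%:R * (2 `^ s * w j + eta / 2 ^+ j.+1)].
  move=> j; apply: (open_enlargement s0 H) => //.
  by rewrite divr_gt0// exprn_gt0.
have /choice[K HK] : forall j, exists K, forall l, (K <= l)%N -> (hit_count (V j) l)%:R <=
      (size (centers l))%:R * (2 `^ s * w j + eta / 2 ^+ j.+1).
  by move=> j; have [_ _] := HV j.
have : cover_compact limit_set by rewrite -compact_cover; exact: limit_set_compact.
move=> /(_ nat setT V) [||D _ ED].
- by move=> j _; have [] := HV j.
- by move=> x /UE[j _ Ujx]; exists j => //; have [_ + _] := HV j; apply.
pose J := (\max_(j <- finmap.enum_fset D) j).+1.
have DJ j : j \in finmap.enum_fset D -> (j < J)%N.
  by move=> jD; rewrite ltnS (@leq_bigmax_seq _ _ xpredT id).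
pose l := \max_(j < J) K j.
(* Level [l] is past all thresholds [K j]. Each of its balls contains a point of [limit_set], so it
   is counted for some [V j] of the finite subcover. *)
have cover_l : (size (centers l) <= \sum_(j < J) hit_count (V j) l)%N.
  rewrite /hit_count -sum1_size; under [leqRHS]eq_bigr do rewrite -sum1_count big_mkcond.
  rewrite exchange_big /= [leqLHS]big_seq [leqRHS]big_seq; apply: leq_sum => c cl.
  have [x /ED[j /= jD Vjx] xc] := limit_set_meets_ball cl.
  rewrite (bigD1 (Ordinal (DJ j jD)))//= (_ : hits _ _ _ = true) ?leq_addr//.
  by apply/asboolP; exists x.
have T0 : 0 < (size (centers l))%:R :> R by rewrite ltr0n size_centers_gt0.
have : (size (centers l))%:R <=
    (size (centers l))%:R * \sum_(j < J) (2 `^ s * w j + eta / 2 ^+ j.+1) :> R.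
  apply: (@le_trans _ _ (\sum_(j < J) hit_count (V j) l)%:R); first by rewrite ler_nat.
  rewrite natr_sum mulr_sumr; apply: ler_sum => j _; apply: HK.
  by rewrite /l (bigD1 j)//= leq_maxl.
rewrite -[leLHS]mulr1 ler_pM2l// big_split /= -mulr_sumr -mulr_sumr.
have geo i : \sum_(j < i) (2 ^+ j.+1)^-1 = 1 - (2 ^+ i)^-1 :> R.
  elim: i => [|i IH]; first by rewrite big_ord0 expr0 invr1 subrr.
  rewrite big_ord_recr /= IH exprS invfM; move: (2 ^+ i)^-1 => z; lra.
have : \sum_(j < J) (2 ^+ j.+1)^-1 <= 1 :> R.
  by rewrite geo gerBl invr_ge0 exprn_ge0.
have := sum_w J; move: (\sum_(j < J) w j) (\sum_(j < J) _) => a b ha hb hc.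
have := ler_wpM2l ps ha; have := ler_wpM2l (ltW eta0) hb => h1 h2.
have : 1 <= (2 `^ s + 1) * eta by lra.
by rewrite /eta invfM mulrCA divff ?mulr1; lra.
Qed.

Lemma limit_set_measure_eq0 (s : R) : 0 < s ->
  (forall (e : R) K, 0 < e -> exists2 k, (K <= k)%N & (size (centers k))%:R * rho k `^ s <= e) ->
  hausdorff_measure s limit_set = 0%E.
Proof.
move=> s0 H; apply: hausdorff_measure_eq0 => e e0.
(* A sup-norm ball of radius [rho] has Euclidean diameter at most [2 * n * rho]; the extra 1 keeps
   [a] positive when [n = 0]. *)
pose a : R := 2 * n%:R + 1.
have a0 : 0 < a by rewrite ltr_wpDl.
have [K HK] := rho_small (divr_gt0 e0 a0).
have [|k Kk Hk] := H (e / a `^ s) K; first by rewrite divr_gt0 ?powR_gt0.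
have ark : a * rho k <= e.
  by rewrite mulrC -ler_pdivlMr// (le_trans _ (ltW HK))// rho_decr.
have diam_ball c : (diam [set x : 'rV[R]_n | (`|x - c| <= rho k)%R] <= (a * rho k)%:E)%E.
  apply: (le_trans (diam_closed_ball_le _ (ltW (rho_gt0 k)))).
  by rewrite lee_fin ler_wpM2r ?(ltW (rho_gt0 k))// lerDl.
pose V j := if (j < size (centers k))%N
  then [set x : 'rV[R]_n | (`|x - nth 0 (centers k) j| <= rho k)%R] else set0.
exists V; split; first split.
- move=> x /(_ k I)[c ck xc]; exists (index c (centers k)) => //.
  by rewrite /V index_mem ck /= nth_index.
- move=> j; rewrite /V; case: ifP => _; first by rewrite (le_trans (diam_ball _))// lee_fin.
  by apply: diam_le => //; exact: ltW.
rewrite (nneseries_split 0%N (size (centers k))); last by move=> j _; exact: hausdorff_weight_ge0.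
rewrite [X in (_ + X)%E]eseries0 ?adde0; last first.
  move=> j; rewrite add0n => kj _; rewrite /V ltnNge kj /= /hausdorff_weight.
  by case: asboolP.
rewrite add0n big_mkord.
apply: (@le_trans _ _ (\sum_(j < size (centers k)) ((a * rho k) `^ s)%:E)%E).
  apply: lee_sum => j _; rewrite /hausdorff_weight; case: asboolP => _.
    by rewrite lee_fin powR_ge0.
  rewrite /V ltn_ord -poweR_EFin; apply: gt0_ler_poweR; rewrite ?(ltW s0)//.
  - by rewrite in_itv /= diam_ge0 leey.
  - by rewrite in_itv /= leey andbT lee_fin mulr_ge0// ltW.
rewrite sumEFin lee_fin sumr_const card_ord -[leLHS]mulr_natl powRM ?(ltW a0) ?(ltW (rho_gt0 k))//.
by rewrite mulrCA mulrC -ler_pdivlMr ?powR_gt0.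
Qed.

End NestedBalls.

(** * Choice of the scales *)

Section Scales.
Context {R : realType}.

Lemma nat_powR_ge (a A B : R) : 0 < a -> 0 <= B ->
  exists M : nat, [/\ (0 < M)%N, A <= M%:R & B <= M%:R `^ a].
Proof.
move=> a0 B0; pose C := `|A| + B `^ a^-1.
have C0 : 0 <= B `^ a^-1 := powR_ge0 _ _.
have CM : C <= (Num.truncn C).+1%:R by exact/ltW/truncnS_gt.
exists (Num.truncn C).+1; split=> //.
  by rewrite (le_trans _ CM)// (le_trans (ler_norm A))// lerDl.
apply: (@le_trans _ _ ((B `^ a^-1) `^ a)).
  by rewrite -powRrM mulVf ?gt_eqF// powRr1.
rewrite ge0_ler_powR ?nnegrE ?(ltW a0)//.
by rewrite (le_trans _ CM)// lerDr.
Qed.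

Lemma eventually_invn_le (a b : R) : 0 < b ->
  exists k0, forall k, (k0 <= k)%N -> a / k.+2%:R <= b.
Proof.
move=> b0; exists (Num.truncn (a / b)).+1 => k /ltnW kk.
rewrite ler_pdivrMr// mulrC -ler_pdivrMr//.
by rewrite (le_trans (ltW (truncnS_gt _)))// ler_nat leqW// leqW.
Qed.

Variables (n d : nat).
Hypotheses (n_gt0 : (0 < n)%N) (d_gt0 : (0 < d)%N).

Let s0 : R := n%:R / d%:R.

Let s0_gt0 : 0 < s0. Proof. by rewrite divr_gt0 ?ltr0n. Qed.

(** From [d * s0 = n]: raised to the power [s0 + del], the child radius gives [x ^ - n], which
    cancels the number of children, and a remainder [x ^ - (d * del)]. *)
Lemma powR_scale (eps del x : R) : 0 < eps -> 0 < x ->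
  (eps / x ^+ d) `^ (s0 + del) = eps `^ (s0 + del) / x ^+ n / x `^ (d%:R * del).
Proof.
move=> e0 x0; rewrite powRM ?invr_ge0 ?exprn_ge0 ?(ltW e0) ?(ltW x0)//.
rewrite -mulrA; congr (_ * _); rewrite -powR_inv1 ?exprn_ge0 ?(ltW x0)// -powRrM.
rewrite -powR_mulrn ?(ltW x0)// -powRrM mulN1r mulrN mulrDr mulrCA divff ?mulr1; last first.
  by rewrite pnatr_eq0 -lt0n.
rewrite powRN powRD; last by rewrite (gt_eqF x0) implybT.
by rewrite powR_mulrn ?(ltW x0)// invfM.
Qed.

(** Number and radius of the children balance at the exponent [s0] up to constants; shifting the
    exponent by [del] leaves a power of [M] that outgrows every constant fixed earlier. *)
Lemma scale_step (L eps G del rho : R) (T : nat) :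
  1 <= L -> 0 < eps -> 0 < G -> 0 < del -> 0 < rho -> (0 < T)%N ->
  exists M : nat, let kap := Num.truncn (rho * M%:R / (2 * L)) in
    let rho' := eps / M%:R ^+ d in
    [/\ (0 < M)%N, rho * M%:R <= 4 * L * kap%:R, rho' <= rho / 2,
        G <= (T * kap ^ n)%:R * rho' `^ (s0 - del)
      & (T * kap ^ n)%:R * rho' `^ (s0 + del) <= 1].
Proof.
move=> L1 e0 G0 del0 r0 T0.
have L0 : 0 < L by lra.
have dd : 0 < d%:R * del by rewrite mulr_gt0 ?ltr0n.
pose c1 := (rho / (4 * L)) ^+ n * eps `^ (s0 - del).
pose c2 := T%:R * rho ^+ n * eps `^ (s0 + del).
have c10 : 0 < c1 by rewrite mulr_gt0 ?powR_gt0// exprn_gt0// divr_gt0// mulr_gt0.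
have c20 : 0 <= c2 by rewrite !mulr_ge0 ?powR_ge0// exprn_ge0// ltW.
(* [4 * L / rho] makes the truncated quotient at least 2, so that truncation at most halves it;
   [2 * eps / rho] halves the radius; [G / c1] and [c2] serve the last two claims. *)
have [M [M0 MA MB]] :=
  nat_powR_ge (4 * L / rho + 2 * eps / rho) dd
    (addr_ge0 (divr_ge0 (ltW G0) (ltW c10)) c20).
exists M => kap rho'.
have M0R : 0 < M%:R :> R by rewrite ltr0n.
have [q1 q2] : 0 < 4 * L / rho /\ 0 < 2 * eps / rho by rewrite !divr_gt0 ?mulr_gt0.
have x2 : 2 <= rho * M%:R / (2 * L).
  by rewrite ler_pdivlMr ?mulr_gt0// [rho * _]mulrC -ler_pdivrMr//; lra.
have kx : kap%:R <= rho * M%:R / (2 * L) by rewrite truncn_le ltW// (lt_le_trans _ x2).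
have kap_lb : rho * M%:R <= 4 * L * kap%:R.
  have : rho * M%:R / (2 * L) <= 2 * kap%:R.
    have := truncnS_gt (rho * M%:R / (2 * L)); rewrite -/kap -[X in _ < X]natr1; lra.
  by rewrite ler_pdivrMr ?mulr_gt0//; lra.
split=> //.
- rewrite /rho' ler_pdivrMr ?exprn_gt0//.
  have : M%:R <= M%:R ^+ d :> R by rewrite -[leLHS]expr1 ler_weXn2l// ler1n.
  have : 2 * eps <= rho * M%:R by rewrite [rho * _]mulrC -ler_pdivrMr//; lra.
  by nra.
- rewrite /rho' powR_scale// mulrN powRN invrK natrM natrX.
  apply: (@le_trans _ _ (c1 * M%:R `^ (d%:R * del))).
    by rewrite mulrC -ler_pdivrMr//; lra.
  rewrite !mulrA ler_wpM2r ?powR_ge0// ler_pdivlMr ?exprn_gt0//.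
  rewrite /c1 mulrAC -exprMn ler_wpM2r ?powR_ge0//.
  apply: (@le_trans _ _ (kap%:R ^+ n)).
    have h : rho / (4 * L) * M%:R <= kap%:R.
      by rewrite mulrAC ler_pdivrMr ?mulr_gt0// [kap%:R * _]mulrC.
    by rewrite lerXn2r ?nnegrE// mulr_ge0// divr_ge0 ?(ltW r0)// mulr_ge0// ltW.
  by rewrite ler_peMl// ler1n.
- rewrite /rho' powR_scale// natrM natrX mulrA ler_pdivrMr ?powR_gt0// mul1r.
  rewrite mulrA ler_pdivrMr ?exprn_gt0//.
  apply: (@le_trans _ _ (c2 * M%:R ^+ n)).
    rewrite /c2 [leRHS]mulrAC ler_wpM2r ?powR_ge0// -mulrA ler_wpM2l// -exprMn.
    rewrite lerXn2r ?nnegrE ?mulr_ge0 ?(ltW r0)// (le_trans kx)//.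
    rewrite ler_pdivrMr ?mulr_gt0// ler_peMr ?mulr_ge0 ?(ltW r0)//; lra.
  rewrite mulrC [leRHS]mulrC ler_wpM2l ?exprn_ge0 ?(ltW M0R)//.
  by rewrite (le_trans _ MB)// lerDr divr_ge0// ltW.
Qed.

(** The last two conclusions feed the mass distribution argument below [s0] and the covering
    argument above it. As [del k] tends to 0, each exponent other than [s0] is eventually out of its
    range. *)
Lemma scale_sequence (L eps : nat -> R) : (forall k, 1 <= L k) -> (forall k, 0 < eps k) ->
  exists (M kappa T : nat -> nat) (rho : nat -> R),
  [/\ rho 0%N = 1,
      forall k, [/\ (0 < M k)%N, (0 < kappa k)%N, (kappa k)%:R <= rho k * (M k)%:R / (2 * L k),
        rho k.+1 = eps k / (M k)%:R ^+ d & 0 < rho k /\ rho k.+1 <= rho k / 2],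
      T 0%N = 1%N /\ forall k, T k.+1 = (T k * kappa k ^ n)%N,
      forall s, 0 <= s -> s < s0 -> exists k0, forall k r, (k0 <= k)%N ->
        rho k.+1 <= r -> r <= rho k ->
        (6 * (L k * (M k)%:R) * r + 1) ^+ n <= (T k.+1)%:R * r `^ s
    & forall s (e : R) K, s0 < s -> 0 < e -> exists2 k, (K <= k)%N & (T k)%:R * rho k `^ s <= e].
Proof.
move=> L1 eps0.
(* If [M * r >= 1], then [6 * L * M * r + 1 <= 7 * L * M * r], and [rho * M <= 4 * L * kappa] turns
   this into [28 * L^2 * kappa * r / rho]. If [M * r <= 1], the bound [7 * L] suffices. *)
pose G k : R := (28 * L k ^+ 2) ^+ n.
pose del k : R := s0 / k.+2%:R.
have L0 k : 0 < L k by rewrite (lt_le_trans _ (L1 k)).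
have G0 k : 0 < G k by rewrite exprn_gt0// mulr_gt0// exprn_gt0.
have del0 k : 0 < del k by rewrite divr_gt0.
(* The choice covers every state, valid or not, so that the recursion can be written before its
   invariants are proved. With [G k + G k.+1], stage [k] also absorbs the constant of the next
   stage. *)
have /choice[F HF] : forall p : nat * (R * nat), exists M : nat,
    0 < p.2.1 -> (0 < p.2.2)%N ->
    let kap := Num.truncn (p.2.1 * M%:R / (2 * L p.1)) in
    let rho' := eps p.1 / M%:R ^+ d in
    [/\ (0 < M)%N, p.2.1 * M%:R <= 4 * L p.1 * kap%:R, rho' <= p.2.1 / 2,
        G p.1 + G p.1.+1 <= (p.2.2 * kap ^ n)%:R * rho' `^ (s0 - del p.1)
      & (p.2.2 * kap ^ n)%:R * rho' `^ (s0 + del p.1) <= 1].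
  move=> [k [rho T]] /=; case: (ltP 0 rho) => [r0|]; last by exists 0%N.
  case: (posnP T) => [->|T0]; first by exists 0%N.
  have [M HM] := scale_step (L1 k) (eps0 k) (addr_gt0 (G0 k) (G0 k.+1)) (del0 k) r0 T0.
  by exists M.
pose kapf k (st : R * nat) := Num.truncn (st.1 * (F (k, st))%:R / (2 * L k)).
pose st := fix st k : R * nat := if k is k'.+1 then
  (eps k' / (F (k', st k'))%:R ^+ d, (st k').2 * kapf k' (st k') ^ n)%N else (1, 1%N).
pose rho k := (st k).1; pose T k := (st k).2.
pose M k := F (k, st k); pose kappa k := kapf k (st k).
have rhoS k : rho k.+1 = eps k / (M k)%:R ^+ d by [].
have TS k : T k.+1 = (T k * kappa k ^ n)%N by [].
have inv k : 0 < rho k /\ (0 < T k)%N.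
  elim: k => [|k [r0 T0]]; first by [].
  have [M0 kl _ _ _] := HF (k, st k) r0 T0.
  rewrite rhoS TS; split; first by rewrite divr_gt0// exprn_gt0// ltr0n.
  rewrite muln_gt0 T0 expn_gt0 orbC /=; apply/orP; right; rewrite lt0n; apply/eqP => k0.
  have : rho k * (M k)%:R <= 4 * L k * (kappa k)%:R := kl.
  rewrite k0 mulr0 leNgt => /negP; apply.
  by rewrite mulr_gt0// ltr0n.
have {}HF k : [/\ (0 < M k)%N, rho k * (M k)%:R <= 4 * L k * (kappa k)%:R, rho k.+1 <= rho k / 2,
        G k + G k.+1 <= (T k.+1)%:R * rho k.+1 `^ (s0 - del k)
      & (T k.+1)%:R * rho k.+1 `^ (s0 + del k) <= 1].
  by have [r0 T0] := inv k; have := HF (k, st k) r0 T0.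
have rho0 : rho 0%N = 1 by [].
have T0 : T 0%N = 1%N by [].
have kappa_le k : (kappa k)%:R <= rho k * (M k)%:R / (2 * L k).
  by rewrite truncn_le divr_ge0 ?mulr_ge0 ?(ltW (inv k).1) ?(ltW (L0 k)).
clearbody M kappa T rho.
have rho_half k : rho k.+1 <= rho k / 2 by have [] := HF k.
have rho_gt0 k : 0 < rho k by have [] := inv k.
have rho_le1 k : rho k <= 1.
  elim: k => [|k IH]; rewrite ?rho0// (le_trans (rho_half k))//.
  by have := rho_gt0 k; lra.
have powR_exp_le (x a b : R) : 0 < x -> x <= 1 -> a <= b -> x `^ b <= x `^ a.
  by move=> x0 x1 ab; rewrite ger_powR// x0.
exists M, kappa, T, rho; split=> //.
- move=> k; have [M0 kl _ _ _] := HF k; split=> //.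
  rewrite lt0n; apply/eqP => k0; move: kl; rewrite k0 mulr0 leNgt => /negP; apply.
  by rewrite mulr_gt0// ltr0n.
- move=> s s_ge0 ss0.
  have sd : 0 < s0 - s by rewrite subr_gt0.
  have [k1 Hk1] := eventually_invn_le s0 sd.
  have del_le k : (k1 <= k)%N -> s <= s0 - del k by move=> /Hk1 h; rewrite lerBrDr addrC -lerBrDr.
  exists k1.+1 => -[//|k] r; rewrite ltnS => k1k r_lb r_ub.
  have [M0 kl _ HG _] := HF k.+1; have [_ _ _ HG' _] := HF k.
  have r0 : 0 < r := lt_le_trans (rho_gt0 _) r_lb.
  have r1 : r <= 1 := le_trans r_ub (rho_le1 _).
  have M0R : 0 < (M k.+1)%:R :> R by rewrite ltr0n.
  have rM0 : 0 <= (M k.+1)%:R * r by rewrite mulr_ge0// ltW.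
  have L1k := L1 k.+1; have L0k := L0 k.+1.
  have base0 : 0 <= 6 * (L k.+1 * (M k.+1)%:R) * r + 1.
    by rewrite addr_ge0// !mulr_ge0 ?(ltW L0k) ?(ltW M0R) ?(ltW r0).
  (* Below the spacing [1 / M] boundedly many children are met, and the count at level [k.+2]
     suffices. Above it, about the fraction [(r / rho) ^ n] of them is met, at most [(r / rho) ^ s]
     because [s <= n], and the count at level [k.+1] is used. *)
  case: (leP ((M k.+1)%:R * r) 1) => rM.
    apply: (@le_trans _ _ (G k.+1)).
      have h1 := ler_wpM2l (ltW L0k) rM; have h2 := ler_wpM2l (ltW L0k) L1k.
      have h : 6 * (L k.+1 * (M k.+1)%:R) * r + 1 <= 28 * L k.+1 ^+ 2.
        by rewrite expr2; lra.
      by rewrite /G lerXn2r ?nnegrE// (le_trans base0).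
    apply: (@le_trans _ _ (G k.+1 + G k.+2)); first by rewrite lerDl ltW.
    apply: (le_trans HG); rewrite ler_wpM2l//.
    apply: (@le_trans _ _ (r `^ (s0 - del k.+1))).
      rewrite ge0_ler_powR ?nnegrE ?(ltW r0) ?(ltW (rho_gt0 _))//.
      by rewrite (le_trans s_ge0)// del_le// leqW.
    by apply: powR_exp_le => //; apply: del_le; rewrite leqW.
  have rr : r / rho k.+1 <= 1 by rewrite ler_pdivrMr// mul1r.
  have rr0 : 0 < r / rho k.+1 by rewrite divr_gt0.
  have base_le : 6 * (L k.+1 * (M k.+1)%:R) * r + 1 <=
      (28 * L k.+1 ^+ 2) * (kappa k.+1)%:R * (r / rho k.+1).
    have Lr0 : 0 <= 7 * L k.+1 * (r / rho k.+1).
      by rewrite mulr_ge0 ?(ltW rr0)// mulr_ge0 ?(ltW L0k).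
    have := ler_wpM2l Lr0 kl.
    have -> : 7 * L k.+1 * (r / rho k.+1) * (rho k.+1 * (M k.+1)%:R) =
       7 * (L k.+1 * ((M k.+1)%:R * r)).
      by field; rewrite gt_eqF.
    have -> : 7 * L k.+1 * (r / rho k.+1) * (4 * L k.+1 * (kappa k.+1)%:R) =
       28 * L k.+1 ^+ 2 * (kappa k.+1)%:R * (r / rho k.+1) by ring.
    apply: le_trans; have := ler_wpM2l (ltW L0k) (ltW rM); rewrite mulr1; lra.
  apply: (@le_trans _ _ (G k.+1 * (kappa k.+1)%:R ^+ n * (r / rho k.+1) ^+ n)).
    by rewrite /G -!exprMn lerXn2r ?nnegrE// (le_trans base0).
  have sn : s <= n%:R.
    by rewrite (le_trans (ltW ss0))// ler_pdivrMr ?ltr0n// ler_peMr// ler1n.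
  have h1 : (r / rho k.+1) ^+ n <= r `^ s / rho k.+1 `^ s.
    rewrite -powR_mulrn ?(ltW rr0)// (le_trans (powR_exp_le _ _ _ rr0 rr sn))//.
    rewrite powRM ?invr_ge0 ?(ltW r0) ?(ltW (rho_gt0 _))//.
    by rewrite -powR_inv1 ?(ltW (rho_gt0 _))// -powRrM mulN1r powRN.
  have h2 : G k.+1 <= (T k.+1)%:R * rho k.+1 `^ s.
    apply: (@le_trans _ _ (G k + G k.+1)); first by rewrite lerDr ltW.
    by apply: (le_trans HG'); rewrite ler_wpM2l//; apply: powR_exp_le => //; exact: del_le.
  have rs0 : 0 < rho k.+1 `^ s by rewrite powR_gt0.
  apply: (@le_trans _ _
    ((T k.+1)%:R * rho k.+1 `^ s * (kappa k.+1)%:R ^+ n * (r `^ s / rho k.+1 `^ s))).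
    apply: ler_pM; last exact: h1.
    - by apply: mulr_ge0; [exact: ltW | exact: exprn_ge0].
    - by apply/exprn_ge0/ltW.
    - by rewrite ler_wpM2r ?exprn_ge0.
  rewrite [T k.+2]TS natrM natrX.
  rewrite [X in X <= _](_ : _ = (T k.+1)%:R * (kappa k.+1)%:R ^+ n * r `^ s)//.
  move: (r `^ s) (rho k.+1 `^ s) ((kappa k.+1)%:R ^+ n) rs0 => a b c b0.
  by field; rewrite gt_eqF.
move=> s e K ss0 e0.
(* Half of the gap covers [del k]; the other half brings the power of the radius below [e]. *)
have eta0 : 0 < (s - s0) / 2 by lra.
have [k1 Hk1] := eventually_invn_le s0 eta0.
have [k2 Hk2] := rho_small rho0 rho_half (powR_gt0 ((s - s0) / 2)^-1 e0).
pose k := (K + k1 + k2)%N.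
exists k.+1; first by rewrite /k; lia.
have [_ _ _ _ HU] := HF k.
have dk : del k <= (s - s0) / 2 by apply: Hk1; rewrite /k; lia.
have -> : s = (s0 + del k) + (s - s0 - del k) by ring.
rewrite powRD; last by rewrite (gt_eqF (rho_gt0 _)) implybT.
rewrite mulrA -[leRHS]mul1r ler_pM ?mulr_ge0 ?powR_ge0//.
apply: (@le_trans _ _ (rho k.+1 `^ ((s - s0) / 2))).
  by apply: powR_exp_le => //; lra.
apply: (@le_trans _ _ ((e `^ ((s - s0) / 2)^-1) `^ ((s - s0) / 2))); last first.
  by rewrite -powRrM mulVf ?gt_eqF// powRr1// ltW.
rewrite ge0_ler_powR ?nnegrE ?powR_ge0 ?(ltW eta0) ?(ltW (rho_gt0 _))//.
by rewrite (le_trans _ (ltW Hk2))// (rho_decr rho_gt0 rho_half)// /k; lia.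
Qed.

End Scales.

(** * A single stage and the order of the stages *)

Lemma injective_nat_unbounded (h : nat -> nat) : injective h -> forall K, exists t, (K <= h t)%N.
Proof.
move=> hinj K; apply: contrapT => /forallNP hK.
have := @uniq_leq_size _ [seq h t | t <- iota 0 K.+1] (iota 0 K).
rewrite map_inj_uniq// iota_uniq size_map !size_iota ltnn => F.
suff : false by []; apply: F => // _ /mapP[t _ ->].
by rewrite mem_iota /= add0n ltnNge; apply/negP/hK.
Qed.

Lemma rat_vector_dense (R : realType) (n : nat) (x : 'rV[R]_n) (e : R) : 0 < e ->
  exists b : 'rV[rat]_n, `|x - map_mx ratr b| <= e.
Proof.
move=> e0.
have /choice[b Hb] : forall i, exists q : rat, `|x 0 i - ratr q| <= e.
  move=> i; have [|q] := @rat_in_itvoo R (x 0 i - e) (x 0 i + e); first lra.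
  by rewrite in_itv /= => /andP[h1 h2]; exists q; rewrite ler_norml; apply/andP; split; lra.
exists (\row_i b i); apply: mx_norm_le => [|i j]; first exact: ltW.
by rewrite ord1 !mxE.
Qed.

Lemma injective_separated (R : realType) (n m : nat) (x : 'I_m -> 'rV[R]_n) : injective x ->
  exists2 e : R, 0 < e & forall i j, i != j -> e <= `|x i - x j|.
Proof.
move=> xinj; pose e := \big[Num.min/1]_(p : 'I_m * 'I_m | p.1 != p.2) `|x p.1 - x p.2|.
exists e => [|i j ij].
  apply: lt_bigmin => // -[i j] /= ij; rewrite normr_gt0 subr_eq0.
  by apply: contraNneq ij => /xinj ->.
by apply/bigmin_leP; right; exists (i, j).
Qed.

(* A task is a countable amount of data: an index [j] and a finite list of
   rational balls, which label the points of their union. *)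
Lemma exists_schedule (R : realType) (n : nat) (J : Type) (m : J -> nat) (j0 : J) :
  countable [set: J] -> (forall j, (0 < m j)%N) ->
  exists S : nat -> {j : J & 'rV[R]_n -> 'I_(m j)},
  forall j (x : 'I_(m j) -> 'rV[R]_n), injective x ->
  exists2 e : R, 0 < e & forall K, exists k f,
    [/\ (K <= k)%N, S k = existT _ j f & forall i y, `|y - x i| < e -> f y = i].
Proof.
move=> /countable_injP[code codeP] m_gt0.
have /choice[decode decodeP] : forall a, exists j, (exists j', code j' = a) -> code j = a.
  move=> a; have [[j ja]|na] := pselect (exists j', code j' = a); first by exists j.
  by exists j0 => /na.
have decodeK j : decode (code j) = j.
  by apply: codeP; rewrite ?in_setT//; apply: decodeP; exists j.
pose near l (y : 'rV[R]_n) (c : 'rV[rat]_n) := `|y - map_mx ratr c| < l.+1%:R^-1.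
(* Code of an index, ball centres, [l] for the common radius [1 / (l + 1)], and a counter that gives
   each labelling infinitely many codes, hence arbitrarily late stages. *)
pose task := (nat * seq 'rV[rat]_n * nat * nat)%type.
pose default : task := (0%N, [::], 0%N, 0%N).
(* The label is the position of the first ball containing the point, and 0 if this position is not a
   valid label. *)
pose run (t : task) : {j : J & 'rV[R]_n -> 'I_(m j)} :=
  let: (a, b, l, _) := t in
  existT _ (decode a) (fun y => insubd (Ordinal (m_gt0 (decode a))) (find (near l y) b)).
exists (fun k => run (odflt default (unpickle k))) => j x xinj.
have [del del0 xsep] := injective_separated xinj.
(* A ball around [b q] that contains a point near [x i] would put [x q] and [x i] within
   [2 * r < del], which forces [q = i]. *)
have [l ldel] : exists l : nat, (l.+1%:R : R)^-1 < del / 4.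
  exists (Num.truncn (4 / del)); rewrite invf_plt ?posrE ?divr_gt0// invf_div.
  exact: truncnS_gt.
set r : R := _^-1 in ldel; have r0 : 0 < r by rewrite invr_gt0 ltr0n.
have /choice[b Hb] : forall i, exists b : 'rV[rat]_n, `|x i - map_mx ratr b| <= r / 2.
  by move=> i; apply: rat_vector_dense; rewrite divr_gt0.
exists (r / 2); first by rewrite divr_gt0.
move=> K; pose tk t : task := (code j, [seq b i | i <- enum 'I_(m j)], l, t).
have [t Kt] : exists t, (K <= pickle (tk t))%N.
  apply: (injective_nat_unbounded (h := fun t => pickle (tk t))) => t t'.
  by move=> /(pcan_inj (@pickleK _)) [].
exists (pickle (tk t)).
suff [f [fE Hf]] : exists f, run (tk t) = existT _ j f /\ forall i y, `|y - x i| < r / 2 -> f y = i.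
  by exists f; split=> //; rewrite pickleK.
rewrite /run /tk decodeK; eexists; split; first by [].
move=> i y yi; set s := [seq _ | _ <- _].
have size_s : size s = m j by rewrite size_map size_enum_ord.
have nth_s (q : 'I_(m j)) : nth 0 s q = b q.
  by rewrite (nth_map q) ?size_enum_ord// nth_ord_enum.
have near_i : near l y (b i).
  rewrite /near -/r -(subrKA (x i)) (le_lt_trans (ler_normD _ _))//.
  by have := Hb i; lra.
have has_s : has (near l y) s.
  by apply/hasP; exists (b i) => //; apply: map_f; rewrite mem_enum.
have q_lt : (find (near l y) s < m j)%N by rewrite -size_s -has_find.
have := nth_find 0 has_s; rewrite -[find _ _]/(nat_of_ord (Ordinal q_lt)) nth_s => near_q.
apply: val_inj; rewrite val_insubd q_lt; apply/eqP.
apply/negPn/negP => ne.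
have /xsep : Ordinal q_lt != i by apply: contraNneq ne => <-.
set q := Ordinal q_lt in near_q *.
have -> : x q - x i = (x q - map_mx ratr (b q)) - (y - map_mx ratr (b q)) + (y - x i).
  by apply/rowP => c; rewrite !mxE; ring.
move: near_q; rewrite /near -/r => near_q.
have := ler_normD ((x q - map_mx ratr (b q)) - (y - map_mx ratr (b q))) (y - x i).
have := ler_normB (x q - map_mx ratr (b q)) (y - map_mx ratr (b q)).
have := Hb q; lra.
Qed.

Lemma uniform_bound (R : realType) (I : finType) (Q : I -> R -> Prop) :
  (forall i a b, a <= b -> Q i a -> Q i b) -> (forall i, exists a, Q i a) ->
  exists2 a, 1 <= a & forall i, Q i a.
Proof.
move=> Qmono /choice[a Qa]; exists (1 + \sum_i `|a i|).
  by rewrite lerDl sumr_ge0.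
move=> i; apply: Qmono (Qa i); rewrite (le_trans (ler_norm _))// (bigD1 i)//=.
by rewrite addrCA lerDl addr_ge0// sumr_ge0.
Qed.

(** * The children of a ball: pulled-back lattice points *)

Section Stage.
Context {R : realType} {n : nat}.

(** The index [u] counts from the lattice point at or just below [z] in each coordinate, so [z] sits
    near the lower corner of the box of points. *)
Definition lattice_point (M kap : nat) (sigma z : 'rV[R]_n)
    (u : {ffun 'I_n -> 'I_kap}) : 'rV[R]_n :=
  \row_l ((sigma 0 l + (Num.floor (M%:R * z 0 l - sigma 0 l))%:~R + (u l)%:R) / M%:R).

Lemma lattice_point_near M kap sigma z (u : {ffun 'I_n -> 'I_kap}) : (0 < M)%N ->
  `|lattice_point M sigma z u - z| <= kap%:R / M%:R.
Proof.
move=> M0; have M0R : 0 < M%:R :> R by rewrite ltr0n.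
apply: mx_norm_le => [|i l]; first by rewrite divr_ge0.
rewrite ord1 !mxE; set t := M%:R * z 0 l - sigma 0 l.
have -> : (sigma 0 l + (Num.floor t)%:~R + (u l)%:R) / M%:R - z 0 l =
    ((u l)%:R - (t - (Num.floor t)%:~R)) / M%:R.
  by rewrite /t; field; rewrite gt_eqF.
rewrite normrM [`|_^-1|]gtr0_norm ?invr_gt0// ler_wpM2r ?invr_ge0 ?(ltW M0R)//.
have := floor_le_tmp t; have := floorD1_gt t; rewrite intrD1 => h1 h2.
have : (u l).+1%:R <= kap%:R :> R by rewrite ler_nat.
have : 0 <= (u l)%:R :> R by [].
rewrite -[(u l).+1%:R]natr1 ler_norml => h3 h4; apply/andP; split; lra.
Qed.

Lemma lattice_pointB M kap sigma z (u v : {ffun 'I_n -> 'I_kap}) i : (0 < M)%N ->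
  `|(u i)%:R - (v i)%:R| <= M%:R * `|lattice_point M sigma z u - lattice_point M sigma z v|.
Proof.
move=> M0; have M0R : 0 < M%:R :> R by rewrite ltr0n.
have := mx_norm_entry (lattice_point M sigma z u - lattice_point M sigma z v) 0 i.
rewrite !mxE -mulrBl normrM [`|_^-1|]gtr0_norm ?invr_gt0// ler_pdivrMr// => h.
rewrite mulrC (le_trans _ h)//; move: (_ + _%:~R) => a.
by rewrite opprD addrACA subrr add0r.
Qed.

(** [L], [eps] and [child] are produced before [M], [kap] and [rho], which leaves the scales free.
    The bound [4 * (L * eps) <= 1] later separates siblings at the scale of their radii. *)
Lemma stage_construction (m d : nat) (P : mpoly (m * n) rat) (Phi : 'I_m -> 'rV[R]_n -> 'rV[R]_n)
    (f : 'rV[R]_n -> 'I_m) :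
  P != 0 -> (mpoly_deg P <= d)%N -> (forall i, C1_diffeo (Phi i)) ->
  exists (L eps : R)
    (child : nat -> forall kap : nat, 'rV[R]_n -> {ffun 'I_n -> 'I_kap} -> 'rV[R]_n),
  [/\ 1 <= L, 0 < eps, 4 * (L * eps) <= 1,
    forall M kap (rho : R), (0 < M)%N -> rho <= 1 -> kap%:R <= rho * M%:R / (2 * L) ->
      (forall c u, `|c| <= 1 -> `|child M kap c u - c| <= rho / 2) /\
      (forall c (u v : {ffun 'I_n -> 'I_kap}) i, `|c| <= 1 ->
         `|(u i)%:R - (v i)%:R| <= L * M%:R * `|child M kap c u - child M kap c v|)
  & forall M kap (rho : R) (c : 'I_m -> 'rV[R]_n)
        (u : 'I_m -> {ffun 'I_n -> 'I_kap}) (x : 'I_m -> 'rV[R]_n),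
      (0 < M)%N -> rho <= 1 -> kap%:R <= rho * M%:R / (2 * L) ->
      (forall i, `|c i| <= 1) -> (forall i, f (c i) = i) ->
      (forall i, `|x i - child M kap (c i) (u i)| <= eps / M%:R ^+ d) ->
      eval_rows P (\matrix_(i < m) Phi i (x i)) != 0].
Proof.
move=> P0 Pd Phi_diffeo.
have /choice[g Hg] : forall i, exists g, [/\ cancel (Phi i) g, cancel g (Phi i) & C1_map g].
  by move=> i; have [_] := Phi_diffeo i.
have [B B1 HB] : exists2 B : R, 1 <= B & forall i x, `|x| <= 2 -> `|Phi i x| <= B.
  apply: (uniform_bound (Q := fun i B => forall x, `|x| <= 2 -> `|Phi i x| <= B)).
    by move=> i a b ab H x /H /le_trans; apply.
  move=> i; apply: continuous_bounded_on_ball => x.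
  by apply: differentiable_continuous; have [[]] := Phi_diffeo i.
have lip (F : 'I_m -> 'rV[R]_n -> 'rV[R]_n) e : (forall i, C1_map (F i)) ->
    exists2 L : R, 1 <= L & forall i x y, `|x| <= e -> `|y| <= e ->
      `|F i x - F i y| <= L * `|x - y|.
  move=> HF; apply: (uniform_bound (Q := fun i L => forall x y,
    `|x| <= e -> `|y| <= e -> `|F i x - F i y| <= L * `|x - y|)).
    by move=> i a b ab H x y xe ye; rewrite (le_trans (H _ _ xe ye))// ler_wpM2r.
  by move=> i; exact: C1_lipschitz_on_ball.
have [L1 L11 HL1] := lip Phi 2 (fun i => (Phi_diffeo i).1).
have [L2 L21 HL2] := lip g (B + 1) (fun i => let: And3 _ _ h := Hg i in h).
have [sigma [e [e0 He]]] := eval_rows_avoidance (B + 1) P0 Pd.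
pose L := L1 + L2.
have L0 : 0 < L by rewrite /L; lra.
(* With [eps <= e / L], the image of a child ball stays within [e / M ^ d] of its lattice point;
   [1 / (4 * L)] also keeps the child balls inside the ball of radius 2 where the Lipschitz bound
   holds. *)
pose eps := Num.min (e / L) (1 / (4 * L)).
have eps0 : 0 < eps by rewrite lt_min !divr_gt0 ?mulr_gt0.
have Leps : 4 * (L * eps) <= 1.
  have : eps <= 1 / (4 * L) by rewrite ge_min lexx orbT.
  by rewrite ler_pdivlMr ?mulr_gt0//; lra.
have Leps_e : L * eps <= e.
  have : eps <= e / L by rewrite ge_min lexx.
  by rewrite ler_pdivlMr// mulrC.
pose pt M kap c (u : {ffun 'I_n -> 'I_kap}) :=
  lattice_point M (row (f c) sigma) (Phi (f c) c) u.
pose child M kap c u := g (f c) (@pt M kap c u).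
have near M kap rho c (u : {ffun 'I_n -> 'I_kap}) : (0 < M)%N -> rho <= 1 ->
    kap%:R <= rho * M%:R / (2 * L) -> `|c| <= 1 ->
    [/\ `|pt M kap c u| <= B + 1, `|child M kap c u - c| <= rho / 2 & `|child M kap c u| <= 3 / 2].
  move=> M0 rho1 kM c1.
  have M0R : 0 < M%:R :> R by rewrite ltr0n.
  have h1 : `|pt M kap c u - Phi (f c) c| <= rho / (2 * L).
    rewrite (le_trans (lattice_point_near _ _ _ M0))// ler_pdivrMr//.
    by rewrite mulrAC.
  have Phic : `|Phi (f c) c| <= B by apply: HB; lra.
  have rhoL : rho / (2 * L) <= 1 by rewrite ler_pdivrMr ?mulr_gt0//; rewrite /L; lra.
  have ptB : `|pt M kap c u| <= B + 1.
    rewrite -[pt _ _ _ _](subrK (Phi (f c) c)) (le_trans (ler_normD _ _))//; lra.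
  have h2 : `|child M kap c u - c| <= rho / 2.
    have [gK _ _] := Hg (f c); rewrite -[X in _ - X](gK c).
    have Phic1 : `|Phi (f c) c| <= B + 1 by lra.
    rewrite (le_trans (HL2 (f c) _ _ ptB Phic1))//.
    apply: (@le_trans _ _ (L * (rho / (2 * L)))).
      by apply: ler_pM => //; rewrite /L; lra.
    by have -> : L * (rho / (2 * L)) = rho / 2 by field; rewrite gt_eqF.
  split=> //; rewrite -[child _ _ _ _](subrK c) (le_trans (ler_normD _ _))//; lra.
exists L, eps, child; split=> //.
- by rewrite /L; lra.
- move=> M kap rho M0 rho1 kM; split=> [c u c1|c u v i c1]; first by have [] := near M kap rho c u.
  rewrite (le_trans (lattice_pointB (row (f c) sigma) (Phi (f c) c) u v i M0))//.
  rewrite [L * _]mulrC -mulrA ler_wpM2l//.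
  have [_ gK _] := Hg (f c).
  rewrite -/(pt M kap c u) -/(pt M kap c v) -[pt M kap c u]gK -[pt M kap c v]gK.
  have [_ _ hu] := near M kap rho c u M0 rho1 kM c1.
  have [_ _ hv] := near M kap rho c v M0 rho1 kM c1.
  rewrite (le_trans (HL1 (f c) _ _ _ _)) -/(child M kap c u) -/(child M kap c v)//; try lra.
  by rewrite ler_wpM2r// /L; lra.
move=> M kap rho c u x M0 rho1 kM c1 fc xu.
have M0R : 0 < M%:R :> R by rewrite ltr0n.
pose Y : 'M[R]_(m, n) := \matrix_(i < m) pt M kap (c i) (u i).
have chx i : `|x i| <= 2.
  have [_ _ h] := near M kap rho (c i) (u i) M0 rho1 kM (c1 i).
  rewrite -[x i](subrK (child M kap (c i) (u i))) (le_trans (ler_normD _ _))//.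
  have h2 : eps / M%:R ^+ d <= eps.
    by rewrite ler_pdivrMr ?exprn_gt0// ler_peMr ?(ltW eps0)// exprn_ege1// ler1n.
  have L1' : 1 <= L by rewrite /L; lra.
  have := xu i; have := ler_wpM2r (ltW eps0) L1'; lra.
have rows_le (W : 'I_m -> 'rV[R]_n) b : 0 <= b -> (forall i, `|W i| <= b) ->
    `|\matrix_(i < m) W i| <= b.
  move=> b0 Wb; apply: mx_norm_le => // i j; rewrite mxE.
  exact: le_trans (mx_norm_entry _ _ _) (Wb i).
apply: (He M Y) => //.
- move=> i l; exists (Num.floor (M%:R * Phi i (c i) 0 l - sigma i l) + (u i l)%:Z).
  by rewrite !mxE fc rmorphD /= -pmulrn addrA divfK// gt_eqF.
- apply: rows_le => [|i]; first lra.
  by have [] := near M kap rho (c i) (u i) M0 rho1 kM (c1 i).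
- apply: rows_le => [|i]; first lra.
  by rewrite (le_trans (HB i _ (chx i)))//; lra.
rewrite -ler_pdivlMr ?exprn_gt0// (_ : _ - Y =
  \matrix_(i < m) (Phi i (x i) - pt M kap (c i) (u i))); last first.
  by apply/matrixP => i l; rewrite !mxE.
apply: rows_le => [|i]; first by rewrite divr_ge0 ?exprn_ge0// ltW.
have [_ gK _] := Hg (f (c i)).
rewrite -[pt M kap (c i) (u i)]gK -/(child M kap (c i) (u i)) fc.
have [_ _ h] := near M kap rho (c i) (u i) M0 rho1 kM (c1 i).
rewrite (le_trans (HL1 i _ _ (chx i) _))//; first lra.
apply: (@le_trans _ _ (L * (eps / M%:R ^+ d))).
  by apply: ler_pM => //; rewrite /L; lra.
by rewrite mulrA ler_wpM2r// invr_ge0 exprn_ge0.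
Qed.

End Stage.

Theorem theorem6p1 (R : realType) (n : nat) (n_gt0 : (0 < n)%N)
    (J : Type) (J_countable : countable [set: J])
    (m : J -> nat) (m_gt0 : forall j, (0 < m j)%N)
    (P : forall j, mpoly (m j * n) rat) (P_neq0 : forall j, P j != 0)
    (Phi : forall j, 'I_(m j) -> 'rV[R]_n -> 'rV[R]_n)
    (Phi_diffeo : forall j i, C1_diffeo (Phi j i))
    (d : nat) (d_gt0 : (0 < d)%N)
    (d_bound : forall j, (mpoly_deg (P j) <= d)%N)
    (d_attained : exists j, mpoly_deg (P j) = d) :
  exists E : set 'rV[R]_n,
    [/\ compact E,
        hausdorff_dim E = (n%:R / d%:R)%:E
      & forall j, ~ exists x : 'I_(m j) -> 'rV[R]_n,
          [/\ injective x,
              forall i, E (x i)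
            & eval_rows (P j) (\matrix_(i < m j) Phi j i (x i)) = 0]].
Proof.
have [j0 _] := d_attained.
have [S HS] := exists_schedule R n j0 J_countable m_gt0.
have stage_k k := stage_construction (projT2 (S k)) (P_neq0 (projT1 (S k))) (d_bound (projT1 (S k)))
  (Phi_diffeo (projT1 (S k))).
have [L HL] := choice stage_k; have [eps Heps] := choice HL.
have [child Hchild] := choice Heps; move: Hchild => {stage_k HL Heps} Hchild.
have L1 k : 1 <= L k by have [] := Hchild k.
have eps0 k : 0 < eps k by have [] := Hchild k.
have [M [kappa [T [rho [rho0 Hseq [T0 TS] Hlow Hup]]]]] := scale_sequence n_gt0 d_gt0 L1 eps0.
have rho_gt0 k : 0 < rho k by have [_ _ _ _ []] := Hseq k.
have rho_half k : rho k.+1 <= rho k / 2 by have [_ _ _ _ []] := Hseq k.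
have kappa_gt0 k : (0 < kappa k)%N by have [] := Hseq k.
have rho_le1 k : rho k <= 1.
  by rewrite (le_trans (rho_le rho0 rho_half k))// exprn_ile1// invf_le1// ler1n.
pose lam k := L k * (M k)%:R.
have lam_ge0 k : 0 <= lam k by rewrite mulr_ge0// (le_trans _ (L1 k)).
pose ch k := child k (M k) (kappa k).
have ch_near k c u : `|c| <= 1 -> `|ch k c u - c| <= rho k / 2.
  have [M0 _ kM _ _] := Hseq k; have [_ _ _ H _] := Hchild k.
  by have [H1 _] := H _ _ _ M0 (rho_le1 k) kM; exact: H1.
have ch_sep k c (u v : {ffun 'I_n -> 'I_(kappa k)}) i : `|c| <= 1 ->
    `|(u i)%:R - (v i)%:R| <= lam k * `|ch k c u - ch k c v|.
  have [M0 _ kM _ _] := Hseq k; have [_ _ _ H _] := Hchild k.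
  by have [_ H1] := H _ _ _ M0 (rho_le1 k) kM; exact: H1.
(* The product is [3 * L * eps * M / M ^ d], at most [3 / 4] because [d >= 1]. *)
have rho_lam k : 3 * rho k.+1 * lam k < 1.
  have [M0 _ _ -> _] := Hseq k; have [_ _ Le _ _] := Hchild k.
  have M0R : 0 < (M k)%:R :> R by rewrite ltr0n.
  have h : (M k)%:R / (M k)%:R ^+ d <= 1 :> R.
    by rewrite ler_pdivrMr ?exprn_gt0// mul1r -[leLHS]expr1 ler_weXn2l// ler1n.
  have Le0 : 0 <= L k * eps k by rewrite mulr_ge0 ?(ltW (eps0 k))// (le_trans _ (L1 k)).
  have := ler_wpM2l Le0 h.
  have -> : 3 * (eps k / (M k)%:R ^+ d) * lam k = 3 * (L k * eps k * ((M k)%:R / (M k)%:R ^+ d)).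
    by rewrite /lam; move: (_ ^+ d)^-1 => z; ring.
  lra.
have sizeT k : size (centers ch k) = T k.
  by elim: k => [|k IH]; rewrite ?T0// size_centersS IH TS.
exists (limit_set rho ch); split.
- exact: limit_set_compact rho0 rho_gt0.
- apply: hausdorff_dim_eq; last by rewrite divr_ge0.
  + move=> s s_ge0 /(Hlow s s_ge0)[k0 Hk0].
    apply: (limit_set_measure_neq0 kappa_gt0 rho0 rho_gt0 rho_half lam_ge0 ch_near ch_sep
      rho_lam s_ge0 (k0 := k0)).
    by move=> k r k0k r1 r2; rewrite sizeT; exact: Hk0.
  + move=> s s_ge0 ss0; apply: (limit_set_measure_eq0 rho0 rho_gt0 rho_half).
      by rewrite (le_lt_trans _ ss0)// divr_ge0.
    move=> e K e0; have [k Kk Hk] := Hup s e K ss0 e0.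
    by exists k => //; rewrite sizeT.
move=> j [x [xinj xE Px0]].
have [e e0 HSe] := HS j x xinj.
have [K rhoK] := rho_small rho0 rho_half e0.
have [k [f [Kk Sk Hf]]] := HSe K.
(* The parent centre is within [rho k / 2 + rho k.+1 <= rho k < e] of [x i], so stage [k] gives it
   the label [i]. *)
have parent i : exists c, exists u : {ffun 'I_n -> 'I_(kappa k)},
    [/\ `|c| <= 1, f c = i & `|x i - ch k c u| <= rho k.+1].
  have [_ /= /allpairsP[[c u] [/= ck _ ->]] xc] := xE i k.+1 Logic.I.
  exists c, u; have c1 := centers_norm rho0 rho_gt0 rho_half ch_near ck.
  split=> //; apply: Hf; apply: (le_lt_trans _ rhoK).
  apply: (@le_trans _ _ (rho k)); last exact: (rho_decr rho_gt0 rho_half).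
  rewrite distrC -(subrKA (ch k c u)) (le_trans (ler_normD _ _))//.
  by have := ch_near k c u c1; have := rho_half k; lra.
have [c /choice[u Hcu]] := choice parent.
have [M0 _ kM rhoE _] := Hseq k; have [_ _ _ _] := Hchild k.
rewrite Sk /= => /(_ _ _ _ c u x M0 (rho_le1 k) kM) H.
have : eval_rows (P j) (\matrix_(i < m j) Phi j i (x i)) != 0.
  by apply: H => i; have [h1 h2 h3] := Hcu i; rewrite -?rhoE.
by rewrite Px0 eqxx.
Qed.
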